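(* The following are equivalent over $\mathsf{RCA}_0$: (i) The infinite pigeonhole principle $\mathsf{IPP}$. (ii) For any $I\in\mathbb N$ and any family $(U_i)_{i\leq I}$ of open sets, there is an open set $U$ such that $U=\bigcap_{i\leq I}U_i$.
   Context: $\mathsf{RCA}_0$ is the usual base system of second-order arithmetic (basic arithmetic axioms, $\Sigma^0_1$-induction, $\Delta^0_1$-comprehension). ''Equivalent over $\mathsf{RCA}_0$'' means that the equivalence, formalized in second-order arithmetic, is provable in $\mathsf{RCA}_0$. Reals. A real is a Cauchy sequence $x=(x_n)_{n\in\mathbb N}$ of rationals with no rate of convergence given: for each rational $\varepsilon>0$ there is an $N\in\mathbb N$ with $|x_m-x_n|<\varepsilon$ for all $m,n\geq N$. For reals $x,y$: $x\leq y$ means that for each rational $\varepsilon>0$ there is an $N$ with $x_n\leq y_n+\varepsilon$ for all $n\geq N$; $x=y$ means $x\leq y$ and $y\leq x$; $x<y$ means $x\leq y$ but not $x=y$. Addition, multiplication and absolute value are defined pointwise; rationals are identified with constant sequences. Put $B_\delta(y)=\{z\in\mathbb R:|y-z|<\delta\}$. Open sets. A code for an open set is a set $U\subseteq\mathbb N\times\mathbb Q\times\mathbb Q_{>0}$. For a real $x$, write $x\in U$ if there are $N\in\mathbb N$ and $(a,r)\in\mathbb Q\times\mathbb Q_{>0}$ such that $x\in B_r(a)$ and $(n,a,r)\in U$ for all $n\geq N$. A family of open sets is a family of codes (coded as a single set). Equality $U=\bigcap_{i\leq I}U_i$ means that for every real $x$, $x\in U$ holds precisely if $x\in U_i$ for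 all $i\leq I$. $\mathsf{IPP}$ (infinite pigeonhole principle): for any $N\in\mathbb N$ and any $c\colon\mathbb N\to\{0,\ldots,N\}$ there is an $n\leq N$ such that $\{i\in\mathbb N:c(i)=n\}$ is infinite. *)

(* Defs.v *)
From Stdlib Require Import List.
Import ListNotations.

(** Number variables and set variables are separate namespaces of de Bruijn
    indices.  The only set terms are set variables. *)

Inductive term : Type :=
| tvar (k : nat)
| tzero
| tone
| tadd (s t : term)
| tmul (s t : term).

Inductive form : Type :=
| fBot
| fEq (s t : term)
| fLt (s t : term)
| fIn (t : term) (X : nat)
| fImp (A B : form)
| fAllN (A : form)
| fAllS (A : form).

Definition fNot (A : form) : form := fImp A fBot.
Definition fAnd (A B : form) : form := fNot (fImp A (fNot B)).
Definition fOr (A B : form) : form := fImp (fNot A) B.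
Definition fIff (A B : form) : form := fAnd (fImp A B) (fImp B A).
Definition fExN (A : form) : form := fNot (fAllN (fNot A)).
Definition fExS (A : form) : form := fNot (fAllS (fNot A)).

Fixpoint tsub (s : nat -> term) (t : term) : term :=
  match t with
  | tvar k => s k
  | tzero => tzero
  | tone => tone
  | tadd t1 t2 => tadd (tsub s t1) (tsub s t2)
  | tmul t1 t2 => tmul (tsub s t1) (tsub s t2)
  end.

Definition tshift : term -> term := tsub (fun k => tvar (S k)).

Definition scons {T : Type} (x : T) (f : nat -> T) (k : nat) : T :=
  match k with 0 => x | S k' => f k' end.

Definition upN (s : nat -> term) : nat -> term :=
  scons (tvar 0) (fun k => tshift (s k)).
Definition upS (r : nat -> nat) : nat -> nat := scons 0 (fun k => S (r k)).

(** [s] acts on number variables and [r] on set variables. *)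
Fixpoint fsub (s : nat -> term) (r : nat -> nat) (A : form) : form :=
  match A with
  | fBot => fBot
  | fEq t u => fEq (tsub s t) (tsub s u)
  | fLt t u => fLt (tsub s t) (tsub s u)
  | fIn t X => fIn (tsub s t) (r X)
  | fImp A B => fImp (fsub s r A) (fsub s r B)
  | fAllN A => fAllN (fsub (upN s) r A)
  | fAllS A => fAllS (fsub s (upS r) A)
  end.

Definition shiftN : form -> form := fsub (fun k => tvar (S k)) (fun X => X).
Definition shiftS : form -> form := fsub tvar S.
Definition instN (t : term) : form -> form := fsub (scons t tvar) (fun X => X).
Definition instS (X : nat) : form -> form := fsub tvar (scons X (fun Y => Y)).

(** Classical two-sorted natural deduction with equality, from the axioms [T]
    and the hypotheses [G].  Generalization is not restricted by the variables of the axioms, so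
    an axiom with free variables stands for its universal closure. *)

Inductive entails (T : form -> Prop) : list form -> form -> Prop :=
| e_ax G A : T A -> entails T G A
| e_hyp G A : In A G -> entails T G A
| e_impI G A B : entails T (A :: G) B -> entails T G (fImp A B)
| e_impE G A B : entails T G (fImp A B) -> entails T G A -> entails T G B
| e_raa G A : entails T (fNot A :: G) fBot -> entails T G A
| e_allNI G A : entails T (map shiftN G) A -> entails T G (fAllN A)
| e_allNE G A t : entails T G (fAllN A) -> entails T G (instN t A)
| e_allSI G A : entails T (map shiftS G) A -> entails T G (fAllS A)
| e_allSE G A X : entails T G (fAllS A) -> entails T G (instS X A)
| e_refl G t : entails T G (fEq t t)
| e_leibniz G A s t :
    entails T G (fEq s t) -> entails T G (instN s A) -> entails T G (instN t A).

Definition provable (T : form -> Prop) (A : form) : Prop := entails T [] A.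

Inductive bounded : form -> Prop :=
| b_bot : bounded fBot
| b_eq s t : bounded (fEq s t)
| b_lt s t : bounded (fLt s t)
| b_in t X : bounded (fIn t X)
| b_imp A B : bounded A -> bounded B -> bounded (fImp A B)
| b_all t A : bounded A -> bounded (fAllN (fImp (fLt (tvar 0) (tshift t)) A)).

Definition Sigma01 (A : form) : Prop := exists B, bounded B /\ A = fExN B.
Definition Pi01 (A : form) : Prop := exists B, bounded B /\ A = fAllN B.

(** In both axiom schemes the distinguished variable [n] is [tvar 0]. *)

Definition induction_for (A : form) : form :=
  fImp (instN tzero A)
    (fImp (fAllN (fImp A (fsub (scons (tadd (tvar 0) tone) (fun k => tvar (S k)))
                               (fun X => X) A)))
          (fAllN A)).

Definition comprehension_for (A B : form) : form :=
  fImp (fAllN (fIff A B)) (fExS (fAllN (fIff (fIn (tvar 0) 0) (shiftS A)))).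

(** An [hterm] or [hform] is a term or formula depending on the numbers of
    number and set quantifiers around it.  The variable bound at depth [n] is
    [tvar (n' - S n)] when used at depth [n'].  Closed formulas are obtained at
    depth [0]; see [close]. *)

Definition hterm : Type := nat -> term.
Definition hset : Type := nat -> nat.
Definition hform : Type := nat -> nat -> form.

Definition close (A : hform) : form := A 0 0.

Definition hzero : hterm := fun _ => tzero.
Definition hone : hterm := fun _ => tone.
Definition hadd (s t : hterm) : hterm := fun n => tadd (s n) (t n).
Definition hmul (s t : hterm) : hterm := fun n => tmul (s n) (t n).

Definition hEq (s t : hterm) : hform := fun n _ => fEq (s n) (t n).
Definition hLt (s t : hterm) : hform := fun n _ => fLt (s n) (t n).
Definition hIn (t : hterm) (X : hset) : hform := fun n m => fIn (t n) (X m).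
Definition hNot (A : hform) : hform := fun n m => fNot (A n m).
Definition hImp (A B : hform) : hform := fun n m => fImp (A n m) (B n m).
Definition hAnd (A B : hform) : hform := fun n m => fAnd (A n m) (B n m).
Definition hOr (A B : hform) : hform := fun n m => fOr (A n m) (B n m).
Definition hIff (A B : hform) : hform := fun n m => fIff (A n m) (B n m).
Definition hAllN (F : hterm -> hform) : hform :=
  fun n m => fAllN (F (fun n' => tvar (n' - S n)) (S n) m).
Definition hExN (F : hterm -> hform) : hform :=
  fun n m => fExN (F (fun n' => tvar (n' - S n)) (S n) m).
Definition hAllS (F : hset -> hform) : hform :=
  fun n m => fAllS (F (fun m' => m' - S m) n (S m)).
Definition hExS (F : hset -> hform) : hform :=
  fun n m => fExS (F (fun m' => m' - S m) n (S m)).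

Declare Scope hterm_scope.
Delimit Scope hterm_scope with ht.
Bind Scope hterm_scope with hterm.
Declare Scope hform_scope.
Delimit Scope hform_scope with hf.
Bind Scope hform_scope with hform.

Notation "0" := hzero : hterm_scope.
Notation "1" := hone : hterm_scope.
Infix "+" := hadd : hterm_scope.
Infix "*" := hmul : hterm_scope.

Notation "s == t" := (hEq s%ht t%ht) (at level 70) : hform_scope.
Notation "s < t" := (hLt s%ht t%ht) : hform_scope.
Notation "s <= t" := (hOr (hLt s%ht t%ht) (hEq s%ht t%ht)) : hform_scope.
Notation "t 'IN' X" := (hIn t%ht X) (at level 70) : hform_scope.
Notation "~ A" := (hNot A) : hform_scope.
Infix "/\" := hAnd : hform_scope.
Infix "\/" := hOr : hform_scope.
Notation "A ===> B" := (hImp A B) (at level 90, right associativity) : hform_scope.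
Notation "A <===> B" := (hIff A B) (at level 95, no associativity) : hform_scope.
Notation "'ALL' x .. y , A" := (hAllN (fun x => .. (hAllN (fun y => A%hf)) ..))
  (at level 200, x binder, y binder) : hform_scope.
Notation "'EX' x .. y , A" := (hExN (fun x => .. (hExN (fun y => A%hf)) ..))
  (at level 200, x binder, y binder) : hform_scope.
Notation "'ALLS' X .. Y , A" := (hAllS (fun X => .. (hAllS (fun Y => A%hf)) ..))
  (at level 200, X binder, Y binder) : hform_scope.
Notation "'EXS' X .. Y , A" := (hExS (fun X => .. (hExS (fun Y => A%hf)) ..))
  (at level 200, X binder, Y binder) : hform_scope.

Local Open Scope hform_scope.

Inductive RCA0 : form -> Prop :=
| ax_succ_nz : RCA0 (close (ALL n, ~ (n + 1 == 0)))
| ax_succ_inj : RCA0 (close (ALL m n, m + 1 == n + 1 ===> m == n))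
| ax_add_0 : RCA0 (close (ALL m, m + 0 == m))
| ax_add_S : RCA0 (close (ALL m n, m + (n + 1) == (m + n) + 1))
| ax_mul_0 : RCA0 (close (ALL m, m * 0 == 0))
| ax_mul_S : RCA0 (close (ALL m n, m * (n + 1) == m * n + m))
| ax_lt_0 : RCA0 (close (ALL m, ~ (m < 0)))
| ax_lt_S : RCA0 (close (ALL m n, m < n + 1 <===> m < n \/ m == n))
| ax_ind A : Sigma01 A -> RCA0 (induction_for A)
| ax_comp A B : Sigma01 A -> Pi01 B -> RCA0 (comprehension_for A B).

(** (i + j)^2 + i is an injective code for the pair (i, j). *)
Definition hpair (i j : hterm) : hterm := ((i + j) * (i + j) + i)%ht.

(** [X] is (the graph of) a function from the natural numbers to [{j | B j}]. *)
Definition isFun (X : hset) (B : hterm -> hform) : hform :=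
  (ALL z, z IN X ===> EX i j, B j /\ z == hpair i j) /\
  (ALL i, EX j, hpair i j IN X /\ ALL k, hpair i k IN X ===> k == j).

Definition Infinite (P : hterm -> hform) : hform := ALL k, EX i, k <= i /\ P i.

(** [HRat m n d] stands for the fraction (m - n) / d.  A rational number is
    identified with the least code of a fraction that represents it, so that
    each rational has a unique code. *)

Record hrat : Type := HRat { qpos : hterm; qneg : hterm; qden : hterm }.

Definition qcode (q : hrat) : hterm := hpair (hpair (qpos q) (qneg q)) (qden q).

Definition qzero : hrat := HRat 0%ht 0%ht 1%ht.
Definition qopp (p : hrat) : hrat := HRat (qneg p) (qpos p) (qden p).
Definition qadd (p q : hrat) : hrat :=
  HRat (qpos p * qden q + qpos q * qden p)%ht
       (qneg p * qden q + qneg q * qden p)%ht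
       (qden p * qden q)%ht.
Definition qsub (p q : hrat) : hrat := qadd p (qopp q).

Definition qeq (p q : hrat) : hform :=
  qpos p * qden q + qneg q * qden p == qpos q * qden p + qneg p * qden q.
Definition qlt (p q : hrat) : hform :=
  qpos p * qden q + qneg q * qden p < qpos q * qden p + qneg p * qden q.
Definition qle (p q : hrat) : hform := qlt p q \/ qeq p q.

(** [q] is the absolute value of [p]. *)
Definition qisabs (q p : hrat) : hform :=
  (qle qzero p /\ qeq q p) \/ (qle p qzero /\ qeq q (qopp p)).

Definition isRat (q : hrat) : hform :=
  0 < qden q /\
  ALL m n d, 0 < d ===> qeq (HRat m n d) q ===> qcode q <= qcode (HRat m n d).

Definition hAllQ (F : hrat -> hform) : hform :=
  ALL m n d, isRat (HRat m n d) ===> F (HRat m n d).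
Definition hExQ (F : hrat -> hform) : hform :=
  EX m n d, isRat (HRat m n d) /\ F (HRat m n d).

Notation "'ALLQ' x .. y , A" := (hAllQ (fun x => .. (hAllQ (fun y => A%hf)) ..))
  (at level 200, x binder, y binder) : hform_scope.
Notation "'EXQ' x .. y , A" := (hExQ (fun x => .. (hExQ (fun y => A%hf)) ..))
  (at level 200, x binder, y binder) : hform_scope.

(** A sequence [x] of rationals is given by its graph: [x n q] says that the
    rational [q] is the [n]-th entry of [x]. *)
Definition hseq : Type := hterm -> hrat -> hform.

Definition seq_of (X : hset) : hseq := fun n q => hpair n (qcode q) IN X.
Definition seq_const (a : hrat) : hseq := fun _ q => qeq q a.
Definition seq_absdiff (x y : hseq) : hseq := fun n q =>
  EXQ a b, x n a /\ y n b /\ qisabs q (qsub a b).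

Definition Cauchy (x : hseq) : hform :=
  ALLQ e, qlt qzero e ===> EX N, ALL m n, N <= m ===> N <= n ===>
  ALLQ a b d, x m a ===> x n b ===> qisabs d (qsub a b) ===> qlt d e.

Definition isReal (X : hset) : hform :=
  isFun X (fun j => EXQ q, j == qcode q) /\ Cauchy (seq_of X).

Definition rle (x y : hseq) : hform :=
  ALLQ e, qlt qzero e ===> EX N, ALL n, N <= n ===>
  ALLQ a b, x n a ===> y n b ===> qle a (qadd b e).
Definition req (x y : hseq) : hform := rle x y /\ rle y x.
Definition rlt (x y : hseq) : hform := rle x y /\ ~ req x y.

(** [z] lies in the open ball of radius [delta] around [y]. *)
Definition in_ball (z y delta : hseq) : hform := rlt (seq_absdiff y z) delta.

Definition is_triple (u : hterm) : hform :=
  EX n, EXQ a r, qlt qzero r /\ u == hpair n (hpair (qcode a) (qcode r)).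

Definition isOpenCode (U : hset) : hform := ALL u, u IN U ===> is_triple u.

(** The set [W] codes the family of all [{u | (i, u) in W}] with [i <= I]. *)
Definition isOpenFamily (I : hterm) (W : hset) : hform :=
  ALL z, z IN W ===> EX i u, i <= I /\ is_triple u /\ z == hpair i u.

(** Membership of a real in the open set coded by [{u | U u}]. *)
Definition in_open (x : hseq) (U : hterm -> hform) : hform :=
  EX N, EXQ a r, qlt qzero r /\ in_ball x (seq_const a) (seq_const r) /\
  ALL n, N <= n ===> U (hpair n (hpair (qcode a) (qcode r))).

Definition IPP : form := close (
  ALL N, ALLS c, isFun c (fun j => j <= N) ===>
  EX n, n <= N /\ Infinite (fun i => hpair i n IN c)).

Definition OpenIntersections : form := close (
  ALL I, ALLS W, isOpenFamily I W ===>
  EXS U, isOpenCode U /\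
  ALLS X, isReal X ===>
    (in_open (seq_of X) (fun u => u IN U) <===>
     ALL i, i <= I ===> in_open (seq_of X) (fun u => hpair i u IN W))).

(* Main.v *)
From HB Require Import structures.
From mathcomp Require Import all_boot all_order all_algebra.
From mathcomp Require Import boolp.
From Stdlib Require Import Ring.
Require Import Defs.

(** By Gödel's completeness theorem it suffices to prove the equivalence in an
    arbitrary model of RCA0, whose rationals form an ordered field.

    From intersections to the pigeonhole principle: if no colour [n <= N] of [c]
    occurs infinitely often, then the open sets [U_n], in whose code the ball of
    radius [1/(q+1)] around [0] persists up to stage [k] iff [c(j) <> n] for
    [q <= j <= k], all contain [0].  A code of their intersection contains a
    whole ball around [0], hence some real [1/(q+1)]; but that one lies in [U_n]
    only if [c(j) <> n] for all [j >= q], and so [c(q)] is none of the colours.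

    Conversely, let the ball [B] of radius [1/(p+1)] around [a] persist in [U] up
    to stage [n] iff for each [i <= I] some ball with code at most [p] includes
    [B] and has been in the code of [U_i] throughout the stages from [p] to [n].
    As only the finitely many balls with code at most [p] compete, bounded
    collection yields one that works for all [n].  For the other inclusion, a real [x]
    in all [U_i] must have a [p] that works for all [i <= I] simultaneously.
    Otherwise colour each [p] by the first [i] for which it is seen to fail; a colour
    that occurs infinitely often contradicts that [x] lies in [U_i]. *)

Set Implicit Arguments.
Unset Strict Implicit.
Unset Printing Implicit Defensive.

(** * Substitution *)

Lemma tsub_ext s s' t : s =1 s' -> tsub s t = tsub s' t.
Proof. by move=> ss; elim: t => //= [t1 -> t2 ->|t1 -> t2 ->]. Qed.

Lemma tsub_tvar t : tsub tvar t = t.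
Proof. by elim: t => //= [t1 -> t2 ->|t1 -> t2 ->]. Qed.

Lemma tsub_comp s s' t : tsub s' (tsub s t) = tsub (fun k => tsub s' (s k)) t.
Proof. by elim: t => //= [t1 -> t2 ->|t1 -> t2 ->]. Qed.

Lemma upN_ext s s' : s =1 s' -> upN s =1 upN s'.
Proof. by move=> ss [|k] //=; rewrite /tshift ss. Qed.

Lemma upS_ext r r' : r =1 r' -> upS r =1 upS r'.
Proof. by move=> rr [|k] //=; rewrite rr. Qed.

Lemma upN_comp s s' :
  (fun k => tsub (upN s') (upN s k)) =1 upN (fun k => tsub s' (s k)).
Proof. by move=> [|k] //=; rewrite /tshift !tsub_comp. Qed.

Lemma upS_comp r r' : (fun k => upS r' (upS r k)) =1 upS (fun k => r' (r k)).
Proof. by case. Qed.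

Lemma fsub_ext s s' r r' A : s =1 s' -> r =1 r' -> fsub s r A = fsub s' r' A.
Proof.
elim: A s s' r r' => //= [t u|t u|t X|A IA B IB|A IA|A IA] s s' r r' ss rr.
- by rewrite !(tsub_ext _ ss).
- by rewrite !(tsub_ext _ ss).
- by rewrite (tsub_ext _ ss) rr.
- by rewrite (IA s s' r r') // (IB s s' r r').
- by rewrite (IA (upN s) (upN s') r r') //; apply: upN_ext.
- by rewrite (IA s s' (upS r) (upS r')) //; apply: upS_ext.
Qed.

Lemma fsub_comp s s' r r' A :
  fsub s' r' (fsub s r A) = fsub (fun k => tsub s' (s k)) (fun k => r' (r k)) A.
Proof.
elim: A s s' r r' => //= [t u|t u|t X|A IA B IB|A IA|A IA] s s' r r'.
- by rewrite !tsub_comp.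
- by rewrite !tsub_comp.
- by rewrite tsub_comp.
- by rewrite IA IB.
- by rewrite IA; congr fAllN; apply: fsub_ext => //; exact: upN_comp.
- by rewrite IA; congr fAllS; apply: fsub_ext => //; exact: upS_comp.
Qed.

Lemma fsub_id A : fsub tvar id A = A.
Proof.
have upN_id : upN tvar =1 tvar by case.
have upS_id : upS id =1 id by case.
elim: A => //= [t u|t u|t X|A -> B ->|A IA|A IA] //.
- by rewrite !tsub_tvar.
- by rewrite !tsub_tvar.
- by rewrite tsub_tvar.
- by rewrite (fsub_ext _ upN_id (fun _ => erefl)) IA.
- by rewrite (fsub_ext _ (fun _ => erefl) upS_id) IA.
Qed.

Lemma tshift_upN s t : tsub (upN s) (tshift t) = tshift (tsub s t).
Proof. by rewrite /tshift !tsub_comp; apply: tsub_ext. Qed.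

Lemma instN_fsub_upN t s r A :
  instN t (fsub (upN s) r A) = fsub (scons t s) r A.
Proof.
rewrite /instN fsub_comp; apply: fsub_ext => // -[|k] //=.
by rewrite /tshift tsub_comp tsub_tvar.
Qed.

Lemma instS_fsub_upS X s r A : instS X (fsub s (upS r) A) = fsub s (scons X r) A.
Proof.
by rewrite /instS fsub_comp; apply: fsub_ext => [k|[|k]] //=; rewrite tsub_tvar.
Qed.

Lemma fsub_instN s r t A :
  fsub s r (instN t A) = instN (tsub s t) (fsub (upN s) r A).
Proof.
rewrite /instN !fsub_comp; apply: fsub_ext => // -[|k] //=.
by rewrite /tshift tsub_comp tsub_tvar.
Qed.

Lemma fsub_instS s r X A : fsub s r (instS X A) = instS (r X) (fsub s (upS r) A).
Proof.
by rewrite /instS !fsub_comp; apply: fsub_ext => [k|[|k]] //=; rewrite tsub_tvar.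
Qed.

Lemma fsub_upN_shiftN s r A : fsub (upN s) r (shiftN A) = shiftN (fsub s r A).
Proof. by rewrite /shiftN !fsub_comp; apply: fsub_ext. Qed.

Lemma fsub_upS_shiftS s r A : fsub s (upS r) (shiftS A) = shiftS (fsub s r A).
Proof.
by rewrite /shiftS !fsub_comp; apply: fsub_ext => k //=; rewrite tsub_tvar.
Qed.

(** * Completeness *)

Fixpoint term_tree (t : term) : GenTree.tree nat :=
  match t with
  | tvar k => GenTree.Leaf k
  | tzero => GenTree.Node 0 [::]
  | tone => GenTree.Node 1 [::]
  | tadd s t => GenTree.Node 2 [:: term_tree s; term_tree t]
  | tmul s t => GenTree.Node 3 [:: term_tree s; term_tree t]
  end.

Fixpoint tree_term (u : GenTree.tree nat) : term :=
  match u with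
  | GenTree.Leaf k => tvar k
  | GenTree.Node 1 _ => tone
  | GenTree.Node 2 [:: s; t] => tadd (tree_term s) (tree_term t)
  | GenTree.Node 3 [:: s; t] => tmul (tree_term s) (tree_term t)
  | _ => tzero
  end.

Lemma term_treeK : cancel term_tree tree_term.
Proof. by elim=> //= [s -> t ->|s -> t ->]. Qed.

Fixpoint form_tree (A : form) : GenTree.tree nat :=
  match A with
  | fBot => GenTree.Node 0 [::]
  | fEq s t => GenTree.Node 1 [:: term_tree s; term_tree t]
  | fLt s t => GenTree.Node 2 [:: term_tree s; term_tree t]
  | fIn t X => GenTree.Node 3 [:: term_tree t; GenTree.Leaf X]
  | fImp A B => GenTree.Node 4 [:: form_tree A; form_tree B]
  | fAllN A => GenTree.Node 5 [:: form_tree A]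
  | fAllS A => GenTree.Node 6 [:: form_tree A]
  end.

Fixpoint tree_form (u : GenTree.tree nat) : form :=
  match u with
  | GenTree.Node 1 [:: s; t] => fEq (tree_term s) (tree_term t)
  | GenTree.Node 2 [:: s; t] => fLt (tree_term s) (tree_term t)
  | GenTree.Node 3 [:: t; GenTree.Leaf X] => fIn (tree_term t) X
  | GenTree.Node 4 [:: A; B] => fImp (tree_form A) (tree_form B)
  | GenTree.Node 5 [:: A] => fAllN (tree_form A)
  | GenTree.Node 6 [:: A] => fAllS (tree_form A)
  | _ => fBot
  end.

Lemma form_treeK : cancel form_tree tree_form.
Proof. by elim=> //= *; rewrite ?term_treeK; congruence. Qed.

(** Only surjectivity matters for the Henkin construction; numbers that code no tree default to
    [fBot]. *)
Definition form_enum (n : nat) : form :=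
  if unpickle n is Some u then tree_form u else fBot.

Lemma form_enumP A : exists n, form_enum n = A.
Proof. by exists (pickle (form_tree A)); rewrite /form_enum pickleK form_treeK. Qed.

Fixpoint tbound (t : term) : nat :=
  match t with
  | tvar k => k.+1
  | tadd s t | tmul s t => maxn (tbound s) (tbound t)
  | _ => 0
  end.

(** Strict upper bounds for the indices of free variables. They are not lowered under a binder, so
    they may be too large, which does no harm when a fresh variable is sought. *)
Fixpoint nbound (A : form) : nat :=
  match A with
  | fBot => 0
  | fEq s t | fLt s t => maxn (tbound s) (tbound t)
  | fIn t _ => tbound t
  | fImp A B => maxn (nbound A) (nbound B)
  | fAllN A | fAllS A => nbound A
  end.

Fixpoint sbound (A : form) : nat :=
  match A with
  | fIn _ X => X.+1
  | fImp A B => maxn (sbound A) (sbound B)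
  | fAllN A | fAllS A => sbound A
  | _ => 0
  end.

Lemma tsub_bound s s' t :
  (forall k, k < tbound t -> s k = s' k) -> tsub s t = tsub s' t.
Proof.
elim: t => //= [k|t1 I1 t2 I2|t1 I1 t2 I2] H; first exact: H.
- by rewrite I1 ?I2 // => k lt; apply: H; rewrite leq_max lt ?orbT.
- by rewrite I1 ?I2 // => k lt; apply: H; rewrite leq_max lt ?orbT.
Qed.

Lemma fsub_bound s s' r r' A :
  (forall k, k < nbound A -> s k = s' k) ->
  (forall k, k < sbound A -> r k = r' k) -> fsub s r A = fsub s' r' A.
Proof.
elim: A s s' r r' => //= [t u|t u|t X|A IA B IB|A IA|A IA] s s' r r' ss rr.
- by congr fEq; apply: tsub_bound => k lt; apply: ss; rewrite leq_max lt ?orbT.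
- by congr fLt; apply: tsub_bound => k lt; apply: ss; rewrite leq_max lt ?orbT.
- by congr fIn; [exact: tsub_bound | apply: rr].
- by congr fImp; [apply: IA|apply: IB] => k lt; (apply: ss || apply: rr);
    rewrite leq_max lt ?orbT.
- by congr fAllN; apply: IA => // -[|k] //= lt; rewrite ss // ltnW.
- by congr fAllS; apply: IA => // -[|k] //= lt; rewrite rr // ltnW.
Qed.

(** * Quotients by an equivalence relation *)

Section Quotient.
Variables (T : Type) (R : T -> T -> Prop).
Hypotheses (R_refl : forall x, R x x) (R_sym : forall x y, R x y -> R y x).
Hypothesis R_trans : forall x y z, R x y -> R y z -> R x z.

Definition quotient : Type := {P : T -> Prop | exists x, P = R x}.

Definition cls (x : T) : quotient := exist _ (R x) (ex_intro _ x erefl).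

Lemma cls_surj (q : quotient) : exists x, q = cls x.
Proof. by case: q => P [x Px]; exists x; apply: eq_exist. Qed.

Lemma cls_eq x y : cls x = cls y <-> R x y.
Proof.
split=> [[e]|xy]; first by rewrite e; exact: R_refl.
apply: eq_exist => /=; apply: funext => z; apply: propext; split=> [xz|].
  exact: R_trans (R_sym xy) xz.
exact: R_trans xy.
Qed.

Definition repr (q : quotient) : T := projT1 (cid (cls_surj q)).

Lemma reprK q : cls (repr q) = q.
Proof. by rewrite /repr; case: cid => x /= ->. Qed.

Lemma repr_cls x : R (repr (cls x)) x.
Proof. by apply/cls_eq; rewrite reprK. Qed.

End Quotient.

(** * Structures and satisfaction *)

Record structure : Type := Structure {
  dom : Type;
  sets : Type;
  zeroM : dom;
  oneM : dom;
  addM : dom -> dom -> dom;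
  mulM : dom -> dom -> dom;
  ltM : dom -> dom -> Prop;
  memM : dom -> sets -> Prop }.

Fixpoint tval (M : structure) (e : nat -> dom M) (t : term) : dom M :=
  match t with
  | tvar k => e k
  | tzero => zeroM M
  | tone => oneM M
  | tadd s t => addM (tval e s) (tval e t)
  | tmul s t => mulM (tval e s) (tval e t)
  end.

Fixpoint sat (M : structure) (e : nat -> dom M) (f : nat -> sets M) (A : form) : Prop :=
  match A with
  | fBot => False
  | fEq s t => tval e s = tval e t
  | fLt s t => ltM (tval e s) (tval e t)
  | fIn t X => memM (tval e t) (f X)
  | fImp A B => sat e f A -> sat e f B
  | fAllN A => forall d, sat (scons d e) f A
  | fAllS A => forall d, sat e (scons d f) A
  end.

(** All assignments are considered, so an axiom with free variables counts as its universal closure,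
    in accordance with the generalization rules of [entails]. *)
Definition is_model (T : form -> Prop) (M : structure) : Prop :=
  forall A e f, T A -> @sat M e f A.

(** * The Henkin construction *)

Section Completeness.
Variable T : form -> Prop.
Hypothesis T_fsub : forall s r A, T A -> T (fsub s r A).

Notation "G |- A" := (entails T G A) (at level 75).

Lemma e_weaken G G' A : G |- A -> (forall B, List.In B G -> List.In B G') -> G' |- A.
Proof.
move=> d; elim: {G A}d G' =>
  [G A TA|G A GA|G A B _ IH|G A B _ IH _ IH'|G A _ IH|G A _ IH|G A t _ IH
  |G A _ IH|G A X _ IH|G t|G A s t _ IH _ IH'] G' GG'.
- exact: e_ax.
- by apply: e_hyp; apply: GG'.
- by apply: e_impI; apply: IH => C [<-|/GG'] /=; [left|right].
- by apply: e_impE (IH _ GG') (IH' _ GG').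
- by apply: e_raa; apply: IH => C [<-|/GG'] /=; [left|right].
- apply: e_allNI; apply: IH => C /List.in_map_iff[D [<- /GG' DG']].
  exact: List.in_map.
- exact: e_allNE (IH _ GG').
- apply: e_allSI; apply: IH => C /List.in_map_iff[D [<- /GG' DG']].
  exact: List.in_map.
- exact: e_allSE (IH _ GG').
- exact: e_refl.
- exact: e_leibniz (IH _ GG') (IH' _ GG').
Qed.

Lemma e_fsub s r G A : G |- A -> List.map (fsub s r) G |- fsub s r A.
Proof.
move=> d; elim: {G A}d s r =>
  [G A TA|G A GA|G A B _ IH|G A B _ IH _ IH'|G A _ IH|G A _ IH|G A t _ IH
  |G A _ IH|G A X _ IH|G t|G A t u _ IH _ IH'] s r.
- by apply: e_ax; apply: T_fsub.
- by apply: e_hyp; apply: List.in_map.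
- exact: e_impI (IH s r).
- exact: e_impE (IH s r) (IH' s r).
- exact: e_raa (IH s r).
- apply: e_allNI; move: (IH (upN s) r); rewrite !List.map_map.
  by under List.map_ext do rewrite fsub_upN_shiftN.
- by rewrite fsub_instN; apply: e_allNE (IH s r).
- apply: e_allSI; move: (IH s (upS r)); rewrite !List.map_map.
  by under List.map_ext do rewrite fsub_upS_shiftS.
- by rewrite fsub_instS; apply: e_allSE (IH s r).
- exact: e_refl.
- move: (IH s r) (IH' s r); rewrite !fsub_instN; exact: e_leibniz.
Qed.

Definition fresh (b : form -> nat) (G : list form) : nat :=
  List.fold_right (fun A n => maxn (b A) n) 0 G.

Lemma freshP b G A : List.In A G -> b A <= fresh b G.
Proof.
elim: G => //= B G IH [->|/IH le]; first exact: leq_maxl.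
by apply: leq_trans le _; exact: leq_maxr.
Qed.

(** The substitution that sends [c] to variable 0 and shifts all others is applied to the
    derivation. As [c] is fresh, it turns the instance at [c] back into [A] and the hypotheses into
    their shifts, to which generalization applies. *)
Lemma gen_fresh_N G A c :
  fresh nbound G <= c -> nbound A <= c -> G |- instN (tvar c) A -> G |- fAllN A.
Proof.
move=> cG cA d; apply: e_allNI.
pose s k := if k == c then tvar 0 else tvar k.+1.
have := e_fsub s id d.
have -> : fsub s id (instN (tvar c) A) = A.
  rewrite /instN fsub_comp -[RHS]fsub_id; apply: fsub_bound => // -[|k] lt /=.
    by rewrite /s eqxx.
  by rewrite /s ltn_eqF // (leq_trans (ltnW lt) cA).
have -> // : List.map (fsub s id) G = List.map shiftN G.
apply: List.map_ext_in => B /(freshP nbound) le.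
apply: fsub_bound => // k lt; rewrite /s ltn_eqF //.
exact: leq_trans lt (leq_trans le cG).
Qed.

Lemma gen_fresh_S G A c :
  fresh sbound G <= c -> sbound A <= c -> G |- instS c A -> G |- fAllS A.
Proof.
move=> cG cA d; apply: e_allSI.
pose r k := if k == c then 0 else k.+1.
have := e_fsub tvar r d.
have -> : fsub tvar r (instS c A) = A.
  rewrite /instS fsub_comp -[RHS]fsub_id; apply: fsub_bound => // -[|k] lt /=.
    by rewrite /r eqxx.
  by rewrite /r ltn_eqF // (leq_trans (ltnW lt) cA).
have -> // : List.map (fsub tvar r) G = List.map shiftS G.
apply: List.map_ext_in => B /(freshP sbound) le.
apply: fsub_bound => // k lt; rewrite /r ltn_eqF //.
exact: leq_trans lt (leq_trans le cG).
Qed.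

Lemma e_bot G A : G |- fBot -> G |- A.
Proof. by move=> d; apply: e_raa; apply: e_weaken d _ => B; right. Qed.

Lemma e_cut G A B : G |- A -> A :: G |- B -> G |- B.
Proof. by move=> dA /e_impI dB; apply: e_impE dB dA. Qed.

Lemma e_hd G A : A :: G |- A.
Proof. by apply: e_hyp; left. Qed.

Lemma e_tl G A B : G |- B -> A :: G |- B.
Proof. by move=> d; apply: e_weaken d _ => C; right. Qed.

(** Each stage of the Henkin construction is a finite list, so that some variable is fresh. *)

Definition henkin_witness (G : list form) (A : form) : form :=
  match A with
  | fImp (fAllN B) fBot => fNot (instN (tvar (fresh nbound G)) B)
  | fImp (fAllS B) fBot => fNot (instS (fresh sbound G) B)
  | _ => A
  end.

Definition henkin_step (G : list form) (A : form) : list form :=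
  if `[< A :: G |- fBot >] then G else henkin_witness (A :: G) A :: A :: G.

Variable A0 : form.
Hypothesis A0_unprovable : ~ provable T A0.

Fixpoint stage (n : nat) : list form :=
  match n with
  | 0 => [:: fNot A0]
  | n.+1 => henkin_step (stage n) (form_enum n)
  end.

(** If adding the witness led to a contradiction, the instance at the fresh variable would be
    derivable, hence so would the universal formula that [A] negates. *)
Lemma henkin_step_consistent G A : ~ G |- fBot -> ~ henkin_step G A |- fBot.
Proof.
move=> cG; rewrite /henkin_step; case: asboolP => // cA.
rewrite /henkin_witness.
(* When [A] is not a negated universal formula, its witness is [A] itself, which is merely
   repeated. *)
have dflt : ~ A :: A :: G |- fBot by move=> d; apply: cA; apply: e_cut (e_hd _ _) d.
case E: A dflt cA => [||||B C|B|B] // dflt cA.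
case: B E dflt cA => //= B E dflt cA; case: C E dflt cA => // E dflt cA.
- move/e_raa => d; apply: cA; apply: e_impE (e_hd _ _) _.
  by apply: gen_fresh_N d => //=; rewrite maxn0 leq_maxl.
- move/e_raa => d; apply: cA; apply: e_impE (e_hd _ _) _.
  by apply: gen_fresh_S d => //=; rewrite maxn0 leq_maxl.
Qed.

Lemma stage_consistent n : ~ stage n |- fBot.
Proof.
elim: n => [|n IH] /=; first by move/e_raa.
exact: henkin_step_consistent.
Qed.

Lemma stage_mono m n B : m <= n -> List.In B (stage m) -> List.In B (stage n).
Proof.
elim: n => [|n IH]; first by rewrite leqn0 => /eqP->.
rewrite leq_eqVlt => /orP[/eqP->//|lt] /(IH lt) /= Bn.
by rewrite /henkin_step; case: asboolP => // _; right; right.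
Qed.

(** The stages increase and each is consistent, so the union of their consequences is a consistent
    theory. It decides every formula and has a counterexample among the variables for each universal
    formula that it refutes. *)
Definition Th (B : form) : Prop := exists n, stage n |- B.

Lemma Th2 A B C : Th A -> Th B -> (forall G, G |- A -> G |- B -> G |- C) -> Th C.
Proof.
move=> [m dA] [n dB] H; exists (maxn m n); apply: H.
- by apply: e_weaken dA _ => D; apply: stage_mono; exact: leq_maxl.
- by apply: e_weaken dB _ => D; apply: stage_mono; exact: leq_maxr.
Qed.

Lemma Th1 A C : Th A -> (forall G, G |- A -> G |- C) -> Th C.
Proof. by move=> [n dA] H; exists n; apply: H. Qed.

Lemma Th0 C : (forall G, G |- C) -> Th C.
Proof. by move=> H; exists 0. Qed.

Lemma Th_consistent : ~ Th fBot.
Proof. by case=> n; exact: stage_consistent. Qed.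

Lemma Th_complete A : ~ Th A -> Th (fNot A).
Proof.
move=> nA; have [n nE] := form_enumP A.
have [d|d] := pselect (A :: stage n |- fBot); first by exists n; exact: e_impI.
case: nA; exists n.+1; rewrite /= /henkin_step nE; case: asboolP => // _.
by apply: e_tl; exact: e_hd.
Qed.

Lemma Th_imp A B : Th (fImp A B) <-> (Th A -> Th B).
Proof.
split=> [AB TA|AB]; first by apply: Th2 AB TA _ => G; exact: e_impE.
have [TA|nA] := pselect (Th A).
  by apply: Th1 (AB TA) _ => G d; apply: e_impI; exact: e_tl.
apply: Th1 (Th_complete nA) _ => G d; apply: e_impI; apply: e_bot.
by apply: e_impE (e_hd _ _); exact: e_tl.
Qed.

Lemma Th_witness A : Th (fNot A) ->
  exists G, Th (henkin_witness G (fNot A)).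
Proof.
move=> nA; have [n nE] := form_enumP (fNot A); exists (fNot A :: stage n).
have [d|d] := pselect (fNot A :: stage n |- fBot).
  have nnA : Th (fNot (fNot A)) by exists n; exact: e_impI.
  by case: Th_consistent; apply: (Th2 nA nnA) => G dA dB; exact: e_impE dB dA.
exists n.+1; rewrite /= /henkin_step nE; case: asboolP => // _; exact: e_hd.
Qed.

(** If the universal formula is not in [Th], its negation is, and the Henkin witness then refutes an
    instance. *)
Lemma Th_allN A : Th (fAllN A) <-> forall t, Th (instN t A).
Proof.
split=> [AA t|IA]; first by apply: Th1 AA _ => G; exact: e_allNE.
apply: contrapT => /Th_complete /Th_witness[G /=].
by move/Th_imp/(_ (IA _)); exact: Th_consistent.
Qed.

Lemma Th_allS A : Th (fAllS A) <-> forall X, Th (instS X A).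
Proof.
split=> [AA X|IA]; first by apply: Th1 AA _ => G; exact: e_allSE.
apply: contrapT => /Th_complete /Th_witness[G /=].
by move/Th_imp/(_ (IA _)); exact: Th_consistent.
Qed.

Lemma Th_leibniz A s t : Th (fEq s t) -> Th (instN s A) -> Th (instN t A).
Proof. by move=> st As; apply: (Th2 st As) => G; exact: e_leibniz. Qed.

Lemma tsub_tshift u t : tsub (scons u tvar) (tshift t) = t.
Proof. by rewrite /tshift tsub_comp tsub_tvar. Qed.

Lemma Th_eq_refl t : Th (fEq t t).
Proof. by apply: Th0 => G; exact: e_refl. Qed.

Lemma Th_eq_sym s t : Th (fEq s t) -> Th (fEq t s).
Proof.
move=> st; have := @Th_leibniz (fEq (tvar 0) (tshift s)) s t st.
by rewrite /instN /= !tsub_tshift; apply; exact: Th_eq_refl.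
Qed.

Lemma Th_eq_trans s t u : Th (fEq s t) -> Th (fEq t u) -> Th (fEq s u).
Proof.
move=> st tu; have := @Th_leibniz (fEq (tshift s) (tvar 0)) t u tu.
by rewrite /instN /= !tsub_tshift; apply.
Qed.

Let R s t := Th (fEq s t).
Let R_refl : forall t, R t t := Th_eq_refl.
Let R_sym : forall s t, R s t -> R t s := Th_eq_sym.
Let R_trans : forall s t u, R s t -> R t u -> R s u := Th_eq_trans.

(** Numbers are terms modulo provable equality. Sets are the set variables themselves, without a
    quotient, since the language has no equality between sets. *)
Definition henkin : structure := {|
  dom := quotient R;
  sets := nat;
  zeroM := cls R tzero;
  oneM := cls R tone;
  addM := fun p q => cls R (tadd (repr p) (repr q));
  mulM := fun p q => cls R (tmul (repr p) (repr q));
  ltM := fun p q => Th (fLt (repr p) (repr q));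
  memM := fun p X => Th (fIn (repr p) X) |}.

(** The Leibniz rule replaces only variable 0, so the two terms are exchanged one after the other;
    [swap] brings the second one into position 0. *)
Lemma R_congr A s s' t t' : R s s' -> R t t' ->
  Th (fsub (scons s (scons t tvar)) id A) ->
  Th (fsub (scons s' (scons t' tvar)) id A).
Proof.
move=> ss tt st.
have {}st : Th (fsub (scons s' (scons t tvar)) id A).
  have := @Th_leibniz (fsub (upN (scons t tvar)) id A) _ _ ss.
  by rewrite !instN_fsub_upN; apply.
have swap u v : fsub (scons u (scons v tvar)) id A =
    instN v (fsub (scons (tshift u) (scons (tvar 0) (fun k => tvar k.+1))) id A).
  rewrite /instN fsub_comp; apply: fsub_ext => // -[|[|k]] //=.
  by rewrite tsub_tshift.
by move: st; rewrite !swap; exact: Th_leibniz.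
Qed.

Lemma Th_congr2 (F : term -> term -> form) s s' t t' :
  (exists A, forall u v, F u v = fsub (scons u (scons v tvar)) id A) ->
  R s s' -> R t t' -> Th (F s t) <-> Th (F s' t').
Proof.
move=> [A FA] ss tt; rewrite !FA; split; apply: R_congr => //; exact: R_sym.
Qed.

Lemma R_fun2 (F : term -> term -> term) s s' t t' :
  (exists a, forall u v, F u v = tsub (scons u (scons v tvar)) a) ->
  R s s' -> R t t' -> R (F s t) (F s' t').
Proof.
move=> [a Fa] ss tt; rewrite /R.
have shift2 u v w : tsub (scons u (scons v tvar)) (tshift (tshift w)) = w.
  by rewrite /tshift !tsub_comp -[RHS]tsub_tvar; apply: tsub_ext.
rewrite -(shift2 s' t' (F s t)) !Fa.
(* Congruence for functions is congruence for the formula that equates the fixed value [F s t] with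
   [a]; the double shift protects this value from the substitution. *)
apply: (@R_congr (fEq (tshift (tshift (tsub (scons s (scons t tvar)) a))) a)) ss tt _.
by rewrite /= shift2; exact: R_refl.
Qed.

Lemma henkin_tval s t : @tval henkin (fun k => cls R (s k)) t = cls R (tsub s t).
Proof.
have H := repr_cls R_refl R_sym R_trans.
elim: t => //= [t1 -> t2 ->|t1 -> t2 ->]; apply/(cls_eq R_refl R_sym R_trans).
- by apply: R_fun2 => //; exists (tadd (tvar 0) (tvar 1)).
- by apply: R_fun2 => //; exists (tmul (tvar 0) (tvar 1)).
Qed.

(** The truth lemma, by induction on the formula: [Th_imp] rests on completeness of [Th], the
    quantifier cases on Henkin witnesses. *)
Lemma henkin_sat s r A :
  @sat henkin (fun k => cls R (s k)) r A <-> Th (fsub s r A).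
Proof.
have H := repr_cls R_refl R_sym R_trans.
elim: A s r => /= [|t u|t u|t X|A IA B IB|A IA|A IA] s r.
- by split=> // /Th_consistent.
- by rewrite !henkin_tval; exact: cls_eq R_refl R_sym R_trans _ _.
- rewrite !henkin_tval; apply: Th_congr2 => //.
  by exists (fLt (tvar 0) (tvar 1)).
- rewrite henkin_tval; apply: (@Th_congr2 (fun u v => fIn u (r X)) _ _ tone tone) => //.
  by exists (fIn (tvar 0) (r X)).
- by rewrite Th_imp IA IB.
- have key t : @sat henkin (scons (cls R t) (fun k => cls R (s k))) r A <->
      Th (instN t (fsub (upN s) r A)).
    rewrite instN_fsub_upN -IA.
    by have -> : scons (cls R t) (fun k => cls R (s k)) = (fun k => cls R (scons t s k))
      by apply: funext => -[].
  rewrite Th_allN; split=> [SA t|TA q]; first exact/key.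
  by have [t ->] := cls_surj q; apply/key.
- rewrite Th_allS; split=> [SA X|TA X]; first by rewrite instS_fsub_upS -IA.
  by rewrite IA -instS_fsub_upS.
Qed.

Lemma henkin_model : is_model T henkin.
Proof.
move=> A e r TA.
have -> : e = (fun k => cls R (repr (e k))) by apply: funext => k; rewrite reprK.
by apply/henkin_sat; apply: Th0 => G; apply: e_ax; exact: T_fsub.
Qed.

Lemma henkin_refutes : ~ @sat henkin (fun k => cls R (tvar k)) id A0.
Proof.
rewrite henkin_sat fsub_id => TA; apply: Th_consistent.
have /Th_imp : Th (fNot A0) by exists 0; exact: e_hd.
exact.
Qed.

End Completeness.

Theorem completeness (T : form -> Prop) (A : form) :
  (forall s r B, T B -> T (fsub s r B)) ->
  (forall M e f, is_model T M -> @sat M e f A) -> provable T A.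
Proof.
move=> T_fsub TA; apply: contrapT => nA.
exact: (henkin_refutes T_fsub nA (TA _ _ _ (henkin_model T_fsub nA))).
Qed.

(** * Models of RCA0 *)

Lemma bounded_fsub s r A : bounded A -> bounded (fsub s r A).
Proof.
move=> bA; elim: {A}bA s r => /= [|s t|s t|t X|A B _ IA _ IB|t A _ IA] s' r;
  try by constructor.
by rewrite tshift_upN; constructor.
Qed.

(** The basic axioms are closed formulas, and an instance of a scheme becomes the instance for the
    substituted formula, which keeps its complexity. *)
Lemma RCA0_fsub s r A : RCA0 A -> RCA0 (fsub s r A).
Proof.
case=> {A} [||||||||A [B [bB ->]]|A B [A' [bA ->]] [B' [bB ->]]].
- exact: ax_succ_nz.
- exact: ax_succ_inj.
- exact: ax_add_0.
- exact: ax_add_S.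
- exact: ax_mul_0.
- exact: ax_mul_S.
- exact: ax_lt_0.
- exact: ax_lt_S.
- have -> : fsub s r (induction_for (fExN B)) =
      induction_for (fsub (upN s) r (fExN B)).
    move: (fExN B) => F; rewrite /induction_for /= fsub_instN.
    congr (fImp _ (fImp (fAllN (fImp _ _)) _)); rewrite !fsub_comp.
    by apply: fsub_ext => // -[|k] //=; rewrite /tshift tsub_comp; apply: tsub_ext.
  by apply: ax_ind; exists (fsub (upN (upN s)) r B); split=> //; exact: bounded_fsub.
- have -> : fsub s r (comprehension_for (fExN A') (fAllN B')) =
      comprehension_for (fsub (upN s) r (fExN A')) (fsub (upN s) r (fAllN B')).
    by move: (fExN A') => F; rewrite /comprehension_for /= fsub_upS_shiftS.
  apply: ax_comp.
    by exists (fsub (upN (upN s)) r A'); split=> //; exact: bounded_fsub.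
  by exists (fsub (upN (upN s)) r B'); split=> //; exact: bounded_fsub.
Qed.

Lemma tval_tsub M (e : nat -> dom M) s t : tval e (tsub s t) = tval (fun k => tval e (s k)) t.
Proof. by elim: t => //= [t1 -> t2 ->|t1 -> t2 ->]. Qed.

Lemma sat_fsub M (e : nat -> dom M) f s r A :
  sat e f (fsub s r A) <-> sat (fun k => tval e (s k)) (fun k => f (r k)) A.
Proof.
elim: A e f s r => //= [t u|t u|t X|A IA B IB|A IA|A IA] e f s r.
- by rewrite !tval_tsub.
- by rewrite !tval_tsub.
- by rewrite tval_tsub.
- by rewrite IA IB.
- suff H d : sat (scons d e) f (fsub (upN s) r A) <->
      sat (scons d (fun k => tval e (s k))) (fun k => f (r k)) A by split=> h d; apply/H.
  rewrite IA.
  suff -> : (fun k => tval (scons d e) (upN s k)) = scons d (fun k => tval e (s k)) by [].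
  by apply: funext => -[|k] //=; rewrite /tshift tval_tsub.
- suff H d : sat e (scons d f) (fsub s (upS r) A) <->
      sat (fun k => tval e (s k)) (scons d (fun k => f (r k))) A by split=> h d; apply/H.
  rewrite IA.
  suff -> : (fun k => scons d f (upS r k)) = scons d (fun k => f (r k)) by [].
  by apply: funext => -[|k].
Qed.

(** The outermost defined connective of an implication. [vExN2] is there for bounded existential
    quantifiers, which are written as negations of [forall x, A -> ~ B]. *)
Inductive view : Type :=
| vAnd (A B : form)
| vExN (A : form)
| vExN2 (A B : form)
| vExS (A : form)
| vNot (A : form)
| vOr (A B : form)
| vImp (A B : form).

Definition view_not (A : form) : view :=
  match A with
  | fImp A1 (fImp A2 fBot) => vAnd A1 A2
  | fAllN (fImp A1 fBot) => vExN A1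
  | fAllN (fImp A1 (fImp A2 fBot)) => vExN2 A1 A2
  | fAllS (fImp A1 fBot) => vExS A1
  | _ => vNot A
  end.

(** A conjunction or an existential quantifier in the premise is itself a
    negation, but must not be taken for the left half of a disjunction. *)
Definition view_imp (A B : form) : view :=
  match B with
  | fBot => view_not A
  | _ =>
    match A with
    | fImp A1 fBot => match view_not A1 with vNot _ => vOr A1 B | _ => vImp A B end
    | _ => vImp A B
    end
  end.

(** [psat] undoes the encoding of the defined connectives, so that it reduces
    to the intended proposition; the fuel [n] bounds the depth of this. *)
Fixpoint psat_rec (n : nat) (M : structure) (e : nat -> dom M) (f : nat -> sets M)
    (A : form) : Prop :=
  match n with
  | 0 => sat e f A
  | n.+1 =>
    match A with
    | fImp A B =>
      match view_imp A B with
      | vAnd A B => psat_rec n e f A /\ psat_rec n e f B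
      | vExN A => exists d, psat_rec n (scons d e) f A
      | vExN2 A B => exists d, psat_rec n (scons d e) f A /\ psat_rec n (scons d e) f B
      | vExS A => exists d, psat_rec n e (scons d f) A
      | vNot A => ~ psat_rec n e f A
      | vOr A B => psat_rec n e f A \/ psat_rec n e f B
      | vImp A B => psat_rec n e f A -> psat_rec n e f B
      end
    | fAllN A => forall d, psat_rec n (scons d e) f A
    | fAllS A => forall d, psat_rec n e (scons d f) A
    | _ => sat e f A
    end
  end.

(** When the fuel runs out, plain [sat] takes over, so the equivalence with [sat] holds for any
    amount of fuel. *)
Definition psat := psat_rec 100.

Definition view_sat M (e : nat -> dom M) f (v : view) : Prop :=
  match v with
  | vAnd A B => sat e f A /\ sat e f B
  | vExN A => exists d, sat (scons d e) f A
  | vExN2 A B => exists d, sat (scons d e) f A /\ sat (scons d e) f B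
  | vExS A => exists d, sat e (scons d f) A
  | vNot A => ~ sat e f A
  | vOr A B => sat e f A \/ sat e f B
  | vImp A B => sat e f A -> sat e f B
  end.

Lemma view_notP M (e : nat -> dom M) f A : view_sat e f (view_not A) <-> ~ sat e f A.
Proof.
have ex (D : Type) (P : D -> Prop) : (exists d, P d) <-> ~ (forall d, P d -> False).
  split=> [[d p] /(_ d p)//|H]; apply: contrapT => nE.
  by apply: H => d p; apply: nE; exists d.
have ex2 (D : Type) (P Q : D -> Prop) :
    (exists d, P d /\ Q d) <-> ~ (forall d, P d -> Q d -> False).
  split=> [[d [p q]] /(_ d p q)//|H]; apply: contrapT => nE.
  by apply: H => d p q; apply: nE; exists d.
have and (P Q : Prop) : (P /\ Q) <-> ~ (P -> Q -> False) by move: (EM P) (EM Q); tauto.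
case: A => // [A B|A|A].
- by case: B => // B [] //=.
- case: A => // A [] //= B [] //=.
- by case: A => // A [] //=.
Qed.

Lemma view_impP M (e : nat -> dom M) f A B :
  view_sat e f (view_imp A B) <-> sat e f (fImp A B).
Proof.
have [->|nB] := EM (B = fBot); first exact: view_notP.
have [->//|[A1 [-> ->]]] : view_imp A B = vImp A B \/
    exists A1, A = fImp A1 fBot /\ view_imp A B = vOr A1 B.
  have -> : view_imp A B = match A with
    | fImp A1 fBot => match view_not A1 with vNot _ => vOr A1 B | _ => vImp A B end
    | _ => vImp A B
    end by case: B nB.
  case: A => [|? ?|? ?|? ?|A C|A|A]; try by left.
  case: C => [|? ?|? ?|? ?|? ?|?|?]; try by left.
  by case: (view_not A) => *; try (by left); right; exists A.
by rewrite /=; move: (EM (sat e f A1)); tauto.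
Qed.

Lemma psat_recE n M (e : nat -> dom M) f A : psat_rec n e f A <-> sat e f A.
Proof.
elim: n A e f => // n IH [|s t|s t|t X|A B|A|A] e f //.
- rewrite -view_impP /=; case: (view_imp A B) => /= *; rewrite ?IH //.
  + by split=> -[d H]; exists d; move: H; rewrite IH.
  + by split=> -[d H]; exists d; move: H; rewrite !IH.
  + by split=> -[d H]; exists d; move: H; rewrite IH.
- by split=> /= H d; move: (H d); rewrite IH.
- by split=> /= H d; move: (H d); rewrite IH.
Qed.

Lemma psatE M (e : nat -> dom M) f A : psat e f A <-> sat e f A.
Proof. exact: psat_recE. Qed.

(** Variable 0 does not occur, so the term is a shift, as [bounded] demands of the bound of a
    quantifier. *)
Fixpoint closed_at_0 (t : term) : bool :=
  match t with
  | tvar k => 0 < k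
  | tadd s t | tmul s t => closed_at_0 s && closed_at_0 t
  | _ => true
  end.

Lemma closed_at_0P t : closed_at_0 t -> tshift (tsub (fun k => tvar k.-1) t) = t.
Proof.
rewrite /tshift; elim: t => //= [[]//|s IH t IH'|s IH t IH'] /andP[/IH -> /IH' ->] //.
Qed.

(** A decision by computation, so that boundedness of a concrete formula is proved by [erefl]. *)
Fixpoint is_bounded (A : form) : bool :=
  match A with
  | fImp A B => is_bounded A && is_bounded B
  | fAllN (fImp (fLt (tvar 0) t) A) => closed_at_0 t && is_bounded A
  | fAllN _ | fAllS _ => false
  | _ => true
  end.

Lemma is_boundedP A : is_bounded A -> bounded A.
Proof.
move: A; fix IH 1 => -[|s t|s t|t X|A B|A|A] //=; try by constructor.
  by move=> /andP[/IH bA /IH bB]; constructor.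
case: A => // -[]//= -[]//= [|//] t A /andP[/closed_at_0P <- /IH bA].
by constructor.
Qed.

(** The default set extends finite lists of set parameters to assignments. *)
Record model : Type := Model {
  model_structure :> structure;
  model_RCA0 : is_model RCA0 model_structure;
  default_set : sets model_structure }.

(** * Induction and comprehension in a model *)

Section Schemes.
Variable M : model.

(** Variable 0 is the existential witness, variable 1 the induction variable; the others are
    parameters. *)
Lemma ind_Sigma A (e : nat -> dom M) f : is_bounded A ->
  (exists w, psat (scons w (scons (zeroM M) e)) f A) ->
  (forall n, (exists w, psat (scons w (scons n e)) f A) ->
     exists w, psat (scons w (scons (addM n (oneM M)) e)) f A) ->
  forall n, exists w, psat (scons w (scons n e)) f A.
Proof.
move=> /is_boundedP bA H0 HS n.
have key d : (exists w, psat (scons w (scons d e)) f A) <-> sat (scons d e) f (fExN A).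
  rewrite /=; split=> [[w /psatE Aw] /(_ w Aw)//|H].
  by apply: contrapT => nE; apply: H => w Aw; apply: nE; exists w; apply/psatE.
have sA : Sigma01 (fExN A) by exists A.
apply/key; have := model_RCA0 (m := M) e f (ax_ind _ sA).
move: (fExN A) key => F key; rewrite /induction_for => /=; apply.
  apply/sat_fsub; rewrite (_ : (fun k => _) = scons (zeroM M) e); first exact/key.
  by apply: funext => -[].
move=> d /key /HS /key SF; apply/sat_fsub.
rewrite (_ : (fun k => _) = scons (addM d (oneM M)) e) //.
by apply: funext => -[].
Qed.

Lemma psat_shiftN (e : nat -> dom M) f A d : psat (scons d e) f (shiftN A) <-> psat e f A.
Proof. by rewrite !psatE sat_fsub. Qed.

Lemma is_bounded_shiftN A : is_bounded A -> is_bounded (shiftN A).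
Proof.
have bs s r B : is_bounded B -> is_bounded (fsub s r B).
  move: B s r; fix IH 1 => -[|u t|u t|t X|B C|B|B] s r //=.
    by move=> /andP[/IH-> /IH->].
  case: B => // -[]//= -[]//= [|//] t B /andP[/closed_at_0P <- /IH->].
  rewrite tshift_upN andbT.
  by elim: (tsub s _) => //= a -> b ->.
exact: bs.
Qed.

(** A vacuous existential quantifier makes the bounded formula [Sigma01]. *)
Lemma ind_bounded A (e : nat -> dom M) f : is_bounded A ->
  psat (scons (zeroM M) e) f A ->
  (forall n, psat (scons n e) f A -> psat (scons (addM n (oneM M)) e) f A) ->
  forall n, psat (scons n e) f A.
Proof.
move=> bA H0 HS n.
have [||w /psat_shiftN//] :=
  @ind_Sigma (shiftN A) e f (is_bounded_shiftN bA) _ _ n.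
- by exists (zeroM M); apply/psat_shiftN.
- move=> m [w /psat_shiftN/HS H]; exists w; exact/psat_shiftN.
Qed.

Lemma comp_Delta A B (e : nat -> dom M) f : is_bounded A -> is_bounded B ->
  (forall n, (exists w, psat (scons w (scons n e)) f A) <->
             (forall w, psat (scons w (scons n e)) f B)) ->
  exists X, forall n, memM n X <-> exists w, psat (scons w (scons n e)) f A.
Proof.
move=> /is_boundedP bA /is_boundedP bB AB.
have sA : Sigma01 (fExN A) by exists A.
have sB : Pi01 (fAllN B) by exists B.
have keyA d : (exists w, psat (scons w (scons d e)) f A) <-> sat (scons d e) f (fExN A).
  rewrite /=; split=> [[w /psatE Aw] /(_ w Aw)//|H].
  by apply: contrapT => nE; apply: H => w Aw; apply: nE; exists w; apply/psatE.
have keyB d : (forall w, psat (scons w (scons d e)) f B) <-> sat (scons d e) f (fAllN B).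
  by rewrite /=; split=> H w; apply/psatE.
have := model_RCA0 (m := M) e f (ax_comp _ _ sA sB).
move: (fExN A) (fAllN B) keyA keyB => F G keyF keyG.
rewrite /comprehension_for /= => H.
apply: contrapT => nX; apply: H => [d H|X HX].
  by apply: H; rewrite -keyF -keyG AB.
apply: nX; exists X => n; rewrite keyF.
have sF : sat (scons n e) (scons X f) (shiftS F) <-> sat (scons n e) f F.
  exact: sat_fsub.
have := HX n; move: (EM (memM n X)) (EM (sat (scons n e) f F)); tauto.
Qed.

Lemma comp_bounded A (e : nat -> dom M) f : is_bounded A ->
  exists X, forall n, memM n X <-> psat (scons n e) f A.
Proof.
move=> bA; have bA' := is_bounded_shiftN bA.
have [|X HX] := @comp_Delta (shiftN A) (shiftN A) e f bA' bA'.
  move=> n; split=> [[_ /psat_shiftN H] w|H]; first exact/psat_shiftN.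
  by exists (zeroM M).
exists X => n; rewrite HX.
split=> [[_ /psat_shiftN//]|H]; exists (zeroM M); exact/psat_shiftN.
Qed.

End Schemes.

(** * Arithmetic in a model of RCA0 *)

(** The variable bound at depth [k]; the value of the innermost one comes first
    in an environment. *)
Definition nvar (k : nat) : hterm := fun n => tvar (Nat.sub n k.+1).
Definition svar (k : nat) : hset := fun m => Nat.sub m k.+1.

(** The bounds are inclusive.  [hExN] does not encode bounded quantifiers as
    [bounded] formulas, since double negations intervene. *)
Definition hAllB (t : hterm) (F : hterm -> hform) : hform :=
  hAllN (fun x => hImp (hLt x (hadd t hone)) (F x)).
Definition hExB (t : hterm) (F : hterm -> hform) : hform :=
  hNot (hAllN (fun x => hImp (hLt x (hadd t hone)) (hNot (F x)))).

Notation "'ALLB' x 'UPTO' t , A" := (hAllB t%ht (fun x => A%hf))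
  (at level 200, x name, t at level 99) : hform_scope.
Notation "'EXB' x 'UPTO' t , A" := (hExB t%ht (fun x => A%hf))
  (at level 200, x name, t at level 99) : hform_scope.

Declare Scope model_scope.
Delimit Scope model_scope with M.
Notation "0" := (zeroM _) : model_scope.
Notation "1" := (oneM _) : model_scope.
Infix "+" := addM : model_scope.
Infix "*" := mulM : model_scope.
Infix "<" := ltM : model_scope.
Definition leM (M : structure) (x y : dom M) : Prop := ltM x y \/ x = y.
Infix "<=" := leM : model_scope.

Section Arithmetic.
Variable M : model.
Implicit Types (a b c d m n : dom M).

Definition nenv (l : seq (dom M)) : nat -> dom M := foldr scons (fun _ => zeroM M) l.
Definition senv (l : seq (sets M)) : nat -> sets M := foldr scons (fun _ => default_set M) l.

Lemma model_psat A : RCA0 A -> psat (nenv [::]) (senv [::]) A.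
Proof. by move=> ?; apply/psatE; exact: model_RCA0. Qed.

Local Open Scope model_scope.

Lemma succM_neq0 n : n + 1 <> 0.
Proof. exact: (model_psat ax_succ_nz). Qed.

Lemma succM_inj m n : m + 1 = n + 1 -> m = n.
Proof. exact: (model_psat ax_succ_inj). Qed.

Lemma addM0 m : m + 0 = m.
Proof. exact: (model_psat ax_add_0). Qed.

Lemma addMS m n : m + (n + 1) = m + n + 1.
Proof. exact: (model_psat ax_add_S). Qed.

Lemma mulM0 m : m * 0 = 0.
Proof. exact: (model_psat ax_mul_0). Qed.

Lemma mulMS m n : m * (n + 1) = m * n + m.
Proof. exact: (model_psat ax_mul_S). Qed.

Lemma ltM0 m : ~ m < 0.
Proof. exact: (model_psat ax_lt_0). Qed.

Lemma ltMS m n : m < n + 1 <-> m <= n.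
Proof. exact: (model_psat ax_lt_S). Qed.

(** The parameters in [l] are listed last first: [nvar 0] is the last entry, and [nvar (size l)] is
    the induction variable. *)
Ltac model_induction A l s :=
  refine (@ind_bounded M (A%hf (size l).+1 (size s)) (nenv l) (senv s) erefl _ _); cbn.

Lemma add0M n : 0 + n = n.
Proof.
move: n; model_induction (0 + nvar 0 == nvar 0)%hf (Nil (dom M)) (Nil (sets M)).
  by rewrite addM0.
by move=> n IH; rewrite addMS IH.
Qed.

Lemma addSM m n : m + 1 + n = m + n + 1.
Proof.
move: n; model_induction (nvar 0 + 1 + nvar 1 == nvar 0 + nvar 1 + 1)%hf [:: m] (Nil (sets M)).
  by rewrite !addM0.
by move=> n IH; rewrite !addMS IH.
Qed.

Lemma addMC m n : m + n = n + m.
Proof.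
move: n; model_induction (nvar 0 + nvar 1 == nvar 1 + nvar 0)%hf [:: m] (Nil (sets M)).
  by rewrite addM0 add0M.
by move=> n IH; rewrite addSM addMS IH.
Qed.

Lemma addMA a b c : a + (b + c) = a + b + c.
Proof.
move: c; model_induction (nvar 0 + (nvar 1 + nvar 2) == nvar 0 + nvar 1 + nvar 2)%hf
  [:: b; a] (Nil (sets M)).
  by rewrite !addM0.
by move=> n IH; rewrite !addMS IH.
Qed.

Lemma mul0M n : 0 * n = 0.
Proof.
move: n; model_induction (0 * nvar 0 == 0)%hf (Nil (dom M)) (Nil (sets M)).
  by rewrite mulM0.
by move=> n IH; rewrite mulMS IH addM0.
Qed.

Lemma mulSM m n : (m + 1) * n = m * n + n.
Proof.
move: n; model_induction ((nvar 0 + 1) * nvar 1 == nvar 0 * nvar 1 + nvar 1)%hf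
  [:: m] (Nil (sets M)).
  by rewrite !mulM0 addM0.
by move=> n IH; rewrite !mulMS IH !addMS -!(addMA (m * n)) (addMC n).
Qed.

Lemma mulMC m n : m * n = n * m.
Proof.
move: n; model_induction (nvar 0 * nvar 1 == nvar 1 * nvar 0)%hf [:: m] (Nil (sets M)).
  by rewrite mulM0 mul0M.
by move=> n IH; rewrite mulSM mulMS IH.
Qed.

Lemma mulMDl a b c : (a + b) * c = a * c + b * c.
Proof.
move: c; model_induction ((nvar 0 + nvar 1) * nvar 2 == nvar 0 * nvar 2 + nvar 1 * nvar 2)%hf
  [:: b; a] (Nil (sets M)).
  by rewrite !mulM0 addM0.
move=> n IH; rewrite !mulMS IH -!addMA; congr addM.
by rewrite addMC -addMA (addMC b).
Qed.

Lemma mulMA a b c : a * (b * c) = a * b * c.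
Proof.
move: c; model_induction (nvar 0 * (nvar 1 * nvar 2) == nvar 0 * nvar 1 * nvar 2)%hf
  [:: b; a] (Nil (sets M)).
  by rewrite !mulM0.
by move=> n IH; rewrite !mulMS -IH mulMC mulMDl !(mulMC _ a).
Qed.

Lemma mul1M n : 1 * n = n.
Proof. by rewrite -(add0M 1) mulSM mul0M add0M. Qed.

Lemma model_semi_ring : semi_ring_theory (zeroM M) (oneM M) (@addM M) (@mulM M) eq.
Proof.
split; [exact: add0M|exact: addMC|exact: addMA|exact: mul1M|exact: mul0M
  |exact: mulMC|exact: mulMA|exact: mulMDl].
Qed.

Add Ring model_ring : model_semi_ring.

Lemma addM_cancel a b c : a + c = b + c -> a = b.
Proof.
move: c; model_induction (nvar 0 + nvar 2 == nvar 1 + nvar 2 ===> nvar 0 == nvar 1)%hf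
  [:: b; a] (Nil (sets M)).
  by rewrite !addM0.
by move=> n IH; rewrite !addMS => /succM_inj.
Qed.

Lemma ltM_addS a c : a < a + (c + 1).
Proof.
move: c; model_induction (nvar 0 < nvar 0 + (nvar 1 + 1))%hf [:: a] (Nil (sets M)).
  by rewrite add0M ltMS; right.
by move=> n IH; rewrite addMS ltMS; left.
Qed.

Lemma ltM_exS a b : a < b -> exists c, b = a + (c + 1).
Proof.
(* For [Sigma01] induction the existential quantifier has to stand in front of the implication; any
   [c] will do when [a < b] fails. *)
suff: exists c, ~ a < b \/ b = a + (c + 1) by case=> c [nab /nab//|-> _]; exists c.
have := @ind_Sigma M ((~ (nvar 0 < nvar 1) \/ nvar 1 == nvar 0 + (nvar 2 + 1))%hf 3%N 0%N)
   (nenv [:: a]) (senv [::]) erefl; cbn => H; move: b; apply: H.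
  by exists 0; left; exact: ltM0.
move=> b [c IH].
have [ab|nab] := EM (a < b + 1); last by exists 0; left.
case/ltMS: ab => [ab|->]; last by exists 0; right; rewrite add0M.
by case: IH => // ->; exists (c + 1); right; ring.
Qed.

Lemma ltM_ex a b : a < b <-> exists c, b = a + (c + 1).
Proof. by split=> [/ltM_exS//|[c ->]]; exact: ltM_addS. Qed.

Lemma zero_or_posM c : c = 0 \/ 0 < c.
Proof.
move: c; model_induction (nvar 0 == 0 \/ 0 < nvar 0)%hf (Nil (dom M)) (Nil (sets M)).
  by left.
by move=> a [->|a0]; right; rewrite ltMS; [right|left].
Qed.

Lemma zero_or_succM c : c = 0 \/ exists c', c = c' + 1.
Proof.
have [->|/ltM_ex[c' ->]] := zero_or_posM c; first by left.
by right; exists c'; rewrite add0M.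
Qed.

Lemma ltM_total a b : a < b \/ a = b \/ b < a.
Proof.
move: b; model_induction (nvar 0 < nvar 1 \/ nvar 0 == nvar 1 \/ nvar 1 < nvar 0)%hf
  [:: a] (Nil (sets M)).
  by right; case: (zero_or_posM a); [left|right].
move=> b [ab|[->|/ltM_ex[c ->]]]; first by left; rewrite ltMS; left.
  by left; rewrite ltMS; right.
have [->|[c' ->]] : c = 0 \/ exists c', c = c' + 1 by exact: zero_or_succM.
  by right; left; rewrite add0M.
by right; right; apply/ltM_ex; exists c'; ring.
Qed.

End Arithmetic.

(** * The ordered field of rationals of a model *)

Section RationalField.
Variable M : model.
Local Open Scope model_scope.

Add Ring model_ring' : (model_semi_ring M).

(** The triple [(a, b, d)] stands for [(a - b) / (d + 1)]. *)
Let triple : Type := (dom M * dom M * dom M)%type.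

Definition same_frac (x y : triple) : Prop :=
  let: (a, b, d) := x in let: (a', b', d') := y in
  a * (d' + 1) + b' * (d + 1) = a' * (d + 1) + b * (d' + 1).

Lemma same_frac_refl x : same_frac x x.
Proof. by case: x => [[a b] d]. Qed.

Lemma same_frac_sym x y : same_frac x y -> same_frac y x.
Proof. by move: x y => [[a b] d] [[a' b'] d'] /= E; symmetry. Qed.

Lemma mulM_cancel (a b c : dom M) : a * (c + 1) = b * (c + 1) -> a = b.
Proof.
wlog [->//|/ltM_ex[k ->]] : a b / a = b \/ a < b.
  move=> H; have [ab|[ab|ba]] := ltM_total a b; first by apply: H; right.
    by apply: H; left.
  by move/esym => E; symmetry; apply: H => //; right.
move=> E; exfalso.
(* The product of [k + 1] and [c + 1] would be zero, but it is the successor of [k * c + k + c]. *)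
have : (k * c + k + c) + 1 + a * (c + 1) = 0 + a * (c + 1).
  by rewrite [in RHS]E; ring.
by move/addM_cancel; exact: succM_neq0.
Qed.

Lemma same_frac_trans x y z : same_frac x y -> same_frac y z -> same_frac x z.
Proof.
move: x y z => [[a1 b1] d1] [[a2 b2] d2] [[a3 b3] d3] /= E1 E2.
(* In the absence of subtraction, the terms in [a2] and [b2] are added on both sides; they are
   cancelled together with the factor [d2 + 1]. *)
apply: (@mulM_cancel _ _ d2).
apply: (@addM_cancel _ _ _ (b2 * (d1 + 1) * (d3 + 1) + a2 * (d1 + 1) * (d3 + 1))).
transitivity ((a1 * (d2 + 1) + b2 * (d1 + 1)) * (d3 + 1) +
              (a2 * (d3 + 1) + b3 * (d2 + 1)) * (d1 + 1)); first by ring.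
by rewrite E1 E2; ring.
Qed.

Definition ratM : Type := quotient same_frac.

HB.instance Definition _ := gen_eqMixin ratM.
HB.instance Definition _ := gen_choiceMixin ratM.

Definition frac (a b d : dom M) : ratM := cls same_frac (a, b, d).

Lemma fracP x : exists a b d, x = frac a b d.
Proof. by have [[[a b] d] ->] := cls_surj x; exists a, b, d. Qed.

Lemma frac_eq a b d a' b' d' : frac a b d = frac a' b' d' <->
  a * (d' + 1) + b' * (d + 1) = a' * (d + 1) + b * (d' + 1).
Proof. exact: (cls_eq same_frac_refl same_frac_sym same_frac_trans). Qed.

(** The product of the denominators [d + 1] and [d' + 1] is the successor of [d * d' + d + d'].
    Independence of the representatives is shown in [addqE]. *)
Definition addq (x y : ratM) : ratM :=
  let: (a, b, d) := repr x in let: (a', b', d') := repr y in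
  frac (a * (d' + 1) + a' * (d + 1)) (b * (d' + 1) + b' * (d + 1)) (d * d' + d + d').

Definition mulq (x y : ratM) : ratM :=
  let: (a, b, d) := repr x in let: (a', b', d') := repr y in
  frac (a * a' + b * b') (a * b' + b * a') (d * d' + d + d').

Definition oppq (x : ratM) : ratM := let: (a, b, d) := repr x in frac b a d.

Lemma repr_frac a b d : same_frac (repr (frac a b d)) (a, b, d).
Proof. exact: (repr_cls same_frac_refl same_frac_sym same_frac_trans). Qed.

Lemma addqE a b d a' b' d' : addq (frac a b d) (frac a' b' d') =
  frac (a * (d' + 1) + a' * (d + 1)) (b * (d' + 1) + b' * (d + 1)) (d * d' + d + d').
Proof.
rewrite /addq; move: (repr_frac a b d) (repr_frac a' b' d').
case: (repr _) (repr (frac a' b' d')) => [[u v] w] [[u' v'] w'] /= E E'.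
apply/frac_eq.
transitivity ((u * (d + 1) + b * (w + 1)) * ((d' + 1) * (w' + 1)) +
  (u' * (d' + 1) + b' * (w' + 1)) * ((d + 1) * (w + 1))); first by ring.
by rewrite E E'; ring.
Qed.

Lemma mulqE a b d a' b' d' : mulq (frac a b d) (frac a' b' d') =
  frac (a * a' + b * b') (a * b' + b * a') (d * d' + d + d').
Proof.
rewrite /mulq; move: (repr_frac a b d) (repr_frac a' b' d').
case: (repr _) (repr (frac a' b' d')) => [[u v] w] [[u' v'] w'] /= E E'.
(* The representatives are replaced one factor at a time, so that each step uses just one of the two
   equations. *)
transitivity (frac (a * u' + b * v') (a * v' + b * u') (d * w' + d + w')).
  apply/frac_eq.
  transitivity (((u * (d + 1) + b * (w + 1)) * u' + (a * (w + 1) + v * (d + 1)) * v') * (w' + 1));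
    first by ring.
  transitivity (((a * (w + 1) + v * (d + 1)) * u' + (u * (d + 1) + b * (w + 1)) * v') * (w' + 1));
    first by rewrite E.
  by ring.
apply/frac_eq.
transitivity (((u' * (d' + 1) + b' * (w' + 1)) * a + (a' * (w' + 1) + v' * (d' + 1)) * b) * (d + 1));
  first by ring.
transitivity (((a' * (w' + 1) + v' * (d' + 1)) * a + (u' * (d' + 1) + b' * (w' + 1)) * b) * (d + 1));
  first by rewrite E'.
by ring.
Qed.

Lemma oppqE a b d : oppq (frac a b d) = frac b a d.
Proof.
rewrite /oppq; move: (repr_frac a b d); case: (repr _) => [[u v] w] /= E.
apply/frac_eq; transitivity (a * (w + 1) + v * (d + 1)); first by ring.
by rewrite -E; ring.
Qed.

Lemma addqA : associative addq.
Proof.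
move=> x y z; have [a [b [d ->]]] := fracP x; have [a' [b' [d' ->]]] := fracP y.
by have [a'' [b'' [d'' ->]]] := fracP z; rewrite !addqE; apply/frac_eq; ring.
Qed.

Lemma addqC : commutative addq.
Proof.
move=> x y; have [a [b [d ->]]] := fracP x; have [a' [b' [d' ->]]] := fracP y.
by rewrite !addqE; apply/frac_eq; ring.
Qed.

Lemma add0q : left_id (frac 0 0 0) addq.
Proof. by move=> x; have [a [b [d ->]]] := fracP x; rewrite addqE; apply/frac_eq; ring. Qed.

Lemma addNq : left_inverse (frac 0 0 0) oppq addq.
Proof.
by move=> x; have [a [b [d ->]]] := fracP x; rewrite oppqE addqE; apply/frac_eq; ring.
Qed.

HB.instance Definition _ := GRing.isZmodule.Build ratM addqA addqC add0q addNq.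

Lemma mulqA : associative mulq.
Proof.
move=> x y z; have [a [b [d ->]]] := fracP x; have [a' [b' [d' ->]]] := fracP y.
by have [a'' [b'' [d'' ->]]] := fracP z; rewrite !mulqE; apply/frac_eq; ring.
Qed.

Lemma mulqC : commutative mulq.
Proof.
move=> x y; have [a [b [d ->]]] := fracP x; have [a' [b' [d' ->]]] := fracP y.
by rewrite !mulqE; apply/frac_eq; ring.
Qed.

Lemma mul1q : left_id (frac 1 0 0) mulq.
Proof. by move=> x; have [a [b [d ->]]] := fracP x; rewrite mulqE; apply/frac_eq; ring. Qed.

Lemma mulqDl : left_distributive mulq addq.
Proof.
move=> x y z; have [a [b [d ->]]] := fracP x; have [a' [b' [d' ->]]] := fracP y.
have [a'' [b'' [d'' ->]]] := fracP z; rewrite !addqE !mulqE addqE.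
by apply/frac_eq; ring.
Qed.

Lemma oneq_neq0 : frac 1 0 0 != frac 0 0 0.
Proof.
apply/eqP => /frac_eq E; apply: (@succM_neq0 M 0).
transitivity (1 * (0 + 1) + 0 * (0 + 1) : dom M); first by ring.
by rewrite E; ring.
Qed.

HB.instance Definition _ :=
  GRing.Zmodule_isComNzRing.Build ratM mulqA mulqC mul1q mulqDl oneq_neq0.

Lemma invq_ex (x : ratM) : x != 0%R -> exists y : ratM, (y * x)%R = 1%R.
Proof.
have [a [b [d ->]]] := fracP x => /eqP n0.
have [/ltM_ex[c E]|[E|/ltM_ex[c E]]] := ltM_total a b.
(* Here [b = a + (c + 1)], so the fraction is [- (c + 1) / (d + 1)]. *)
- exists (frac 0 (d + 1) c); rewrite -[LHS]/(mulq _ _) mulqE.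
  by apply/frac_eq; rewrite E; ring.
- by case: n0; apply/frac_eq; rewrite E; ring.
- exists (frac (d + 1) 0 c); rewrite -[LHS]/(mulq _ _) mulqE.
  by apply/frac_eq; rewrite E; ring.
Qed.

Definition invq (x : ratM) : ratM :=
  match pselect (x != 0%R) with
  | left H => projT1 (cid (invq_ex H))
  | right _ => 0%R
  end.

Lemma mulVq (x : ratM) : x != 0%R -> (invq x * x)%R = 1%R.
Proof. by rewrite /invq; case: pselect => // H _; case: cid. Qed.

Lemma invq0 : invq 0%R = 0%R.
Proof. by rewrite /invq; case: pselect => // H; case/eqP: (H). Qed.

HB.instance Definition _ := GRing.ComNzRing_isField.Build ratM mulVq invq0.

Definition nonnegq (x : ratM) : Prop := exists a d, x = frac a 0 d.

Definition leq_ratM (x y : ratM) : bool := `[< nonnegq (y - x)%R >].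
Definition ltq_ratM (x y : ratM) : bool := (y != x) && leq_ratM x y.
Definition normq (x : ratM) : ratM := if leq_ratM 0%R x then x else (- x)%R.

Lemma nonnegq_anti (x : ratM) : nonnegq x -> nonnegq (- x)%R -> x = 0%R.
Proof.
move=> [a [d ->]] [a' [d']]; rewrite -[LHS]/(oppq _) oppqE => /frac_eq E.
suff -> : a = 0 by apply/frac_eq; ring.
have [//|[c Ec]] := zero_or_succM a; exfalso.
apply: (@succM_neq0 M (c * d' + d' + c + a' * (d + 1))).
transitivity (a' * (d + 1) + a * (d' + 1)); first by rewrite Ec; ring.
by rewrite -E; ring.
Qed.

Lemma le0q_add x y : leq_ratM 0%R x -> leq_ratM 0%R y -> leq_ratM 0%R (x + y)%R.
Proof.
rewrite /leq_ratM !GRing.subr0 => /asboolP[a [d ->]] /asboolP[a' [d' ->]].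
apply/asboolP; exists (a * (d' + 1) + a' * (d + 1)), (d * d' + d + d').
by rewrite -[LHS]/(addq _ _) addqE; apply/frac_eq; ring.
Qed.

Lemma le0q_mul x y : leq_ratM 0%R x -> leq_ratM 0%R y -> leq_ratM 0%R (x * y)%R.
Proof.
rewrite /leq_ratM !GRing.subr0 => /asboolP[a [d ->]] /asboolP[a' [d' ->]].
apply/asboolP; exists (a * a'), (d * d' + d + d').
by rewrite -[LHS]/(mulq _ _) mulqE; apply/frac_eq; ring.
Qed.

Lemma le0q_anti x : leq_ratM 0%R x -> leq_ratM x 0%R -> x = 0%R.
Proof.
rewrite /leq_ratM GRing.subr0 GRing.sub0r => /asboolP x0 /asboolP nx0.
exact: nonnegq_anti.
Qed.

Lemma subq_ge0 x y : leq_ratM 0%R (y - x)%R = leq_ratM x y.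
Proof. by rewrite /leq_ratM GRing.subr0. Qed.

Lemma le0q_total x : leq_ratM 0%R x || leq_ratM x 0%R.
Proof.
rewrite /leq_ratM GRing.subr0 GRing.sub0r.
have [a [b [d ->]]] := fracP x.
have [/ltM_ex[c E]|[E|/ltM_ex[c E]]] := ltM_total a b; apply/orP.
- right; apply/asboolP; exists (c + 1), d; rewrite -[LHS]/(oppq _) oppqE.
  by apply/frac_eq; rewrite E; ring.
- by left; apply/asboolP; exists 0, d; apply/frac_eq; rewrite E; ring.
- by left; apply/asboolP; exists (c + 1), d; apply/frac_eq; rewrite E; ring.
Qed.

Lemma normqN x : normq (- x)%R = normq x.
Proof.
rewrite /normq GRing.opprK.
have [x0|x0] := boolP (leq_ratM 0%R x); have [y0|y0] := boolP (leq_ratM 0%R (- x)%R) => //.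
  by rewrite [x]le0q_anti ?GRing.oppr0 // -subq_ge0 GRing.sub0r.
by move: (le0q_total x); rewrite -(subq_ge0 x) GRing.sub0r (negbTE x0) (negbTE y0).
Qed.

Lemma ge0_normq x : leq_ratM 0%R x -> normq x = x.
Proof. by rewrite /normq => ->. Qed.

Lemma ltq_def x y : ltq_ratM x y = (y != x) && leq_ratM x y.
Proof. by []. Qed.

HB.instance Definition _ := Num.IntegralDomain_isLeReal.Build ratM
  le0q_add le0q_mul le0q_anti subq_ge0 le0q_total normqN ge0_normq ltq_def.

(** This order embedding into the field makes tactics for ordered fields applicable to the numbers
    of the model. *)
Definition toq (a : dom M) : ratM := frac a 0 0.

Lemma toqD a b : toq (a + b) = (toq a + toq b)%R.
Proof. by rewrite -[RHS]/(addq _ _) addqE; apply/frac_eq; ring. Qed.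

Lemma toqM a b : toq (a * b) = (toq a * toq b)%R.
Proof. by rewrite -[RHS]/(mulq _ _) mulqE; apply/frac_eq; ring. Qed.

Lemma toq0 : toq 0 = 0%R. Proof. by []. Qed.
Lemma toq1 : toq 1 = 1%R. Proof. by []. Qed.

Lemma toq_inj a b : toq a = toq b -> a = b.
Proof.
move/frac_eq => E; transitivity (a * (0 + 1) + 0 * (0 + 1)); first by ring.
by rewrite E; ring.
Qed.

Lemma toq_ge0 a : (0 <= toq a)%R.
Proof.
suff : leq_ratM 0%R (toq a) by [].
by rewrite /leq_ratM GRing.subr0; apply/asboolP; exists a, 0.
Qed.

Lemma toq_lt a b : (toq a < toq b)%R <-> a < b.
Proof.
have lt x y : x < y -> (toq x < toq y)%R.
  move=> /ltM_ex[c ->]; rewrite !toqD Num.Theory.ltrDl toq1.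
  by apply: Num.Theory.ltr_wpDl; [exact: toq_ge0|exact: Num.Theory.ltr01].
split; last exact: lt.
have [//|[->|/lt ba ab]] := ltM_total a b; first by rewrite Order.POrderTheory.ltxx.
by have := Order.POrderTheory.lt_asym (toq a) (toq b); rewrite ab ba.
Qed.

Lemma ratM_surj (x : ratM) : exists a b d, (x * (toq d + 1))%R = (toq a - toq b)%R.
Proof.
have [a [b [d ->]]] := fracP x; exists a, b, d.
rewrite -toq1 -toqD -[LHS]/(mulq _ _) -[RHS]/(addq _ (oppq _)) oppqE mulqE addqE.
by apply/frac_eq; ring.
Qed.

End RationalField.

From mathcomp Require Import ring lra.
Import Order.TTheory GRing.Theory Num.Theory.
Local Open Scope ring_scope.

(** * The statement in a model *)

Section ModelStatement.
Variable M : structure.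
Local Open Scope model_scope.
Local Notation "t 'IN' X" := (memM t X) (at level 70).

(** This and the following definitions copy those of the formulas, with elements of the model for
    terms, so that [psat] of the two statements is convertible to [IPPM] and
    [OpenIntersectionsM]. *)
Definition pairM (i j : dom M) : dom M := (i + j) * (i + j) + i.

Definition isFunM (X : sets M) (B : dom M -> Prop) : Prop :=
  (forall z, z IN X -> exists i j, B j /\ z = pairM i j) /\
  (forall i, exists j, pairM i j IN X /\ forall k, pairM i k IN X -> k = j).

Definition InfiniteM (P : dom M -> Prop) : Prop := forall k, exists i, k <= i /\ P i.

Record mrat : Type := MRat { mpos : dom M; mneg : dom M; mden : dom M }.

Definition mcode (q : mrat) : dom M := pairM (pairM (mpos q) (mneg q)) (mden q).

Definition mqzero : mrat := MRat 0 0 1.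
Definition mqopp (p : mrat) : mrat := MRat (mneg p) (mpos p) (mden p).
Definition mqadd (p q : mrat) : mrat :=
  MRat (mpos p * mden q + mpos q * mden p) (mneg p * mden q + mneg q * mden p)
       (mden p * mden q).
Definition mqsub (p q : mrat) : mrat := mqadd p (mqopp q).

Definition mqeq (p q : mrat) : Prop :=
  mpos p * mden q + mneg q * mden p = mpos q * mden p + mneg p * mden q.
Definition mqlt (p q : mrat) : Prop :=
  mpos p * mden q + mneg q * mden p < mpos q * mden p + mneg p * mden q.
Definition mqle (p q : mrat) : Prop := mqlt p q \/ mqeq p q.
Definition mqisabs (q p : mrat) : Prop :=
  (mqle mqzero p /\ mqeq q p) \/ (mqle p mqzero /\ mqeq q (mqopp p)).

Definition isRatM (q : mrat) : Prop :=
  0 < mden q /\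
  forall m n d, 0 < d -> mqeq (MRat m n d) q -> mcode q <= mcode (MRat m n d).

Definition allQ (F : mrat -> Prop) : Prop :=
  forall m n d, isRatM (MRat m n d) -> F (MRat m n d).
Definition exQ (F : mrat -> Prop) : Prop :=
  exists m n d, isRatM (MRat m n d) /\ F (MRat m n d).

Definition mseq : Type := dom M -> mrat -> Prop.

Definition seq_ofM (X : sets M) : mseq := fun n q => pairM n (mcode q) IN X.
Definition seq_constM (a : mrat) : mseq := fun _ q => mqeq q a.
Definition seq_absdiffM (x y : mseq) : mseq := fun n q =>
  exQ (fun a => exQ (fun b => x n a /\ y n b /\ mqisabs q (mqsub a b))).

Definition CauchyM (x : mseq) : Prop :=
  allQ (fun e => mqlt mqzero e -> exists N, forall m n, N <= m -> N <= n ->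
  allQ (fun a => allQ (fun b => allQ (fun d =>
    x m a -> x n b -> mqisabs d (mqsub a b) -> mqlt d e)))).

Definition isRealM (X : sets M) : Prop :=
  isFunM X (fun j => exQ (fun q => j = mcode q)) /\ CauchyM (seq_ofM X).

Definition rleM (x y : mseq) : Prop :=
  allQ (fun e => mqlt mqzero e -> exists N, forall n, N <= n ->
  allQ (fun a => allQ (fun b => x n a -> y n b -> mqle a (mqadd b e)))).
Definition rltM (x y : mseq) : Prop := rleM x y /\ ~ (rleM x y /\ rleM y x).
Definition in_ballM (z y delta : mseq) : Prop := rltM (seq_absdiffM y z) delta.

Definition is_tripleM (u : dom M) : Prop :=
  exists n, exQ (fun a => exQ (fun r =>
    mqlt mqzero r /\ u = pairM n (pairM (mcode a) (mcode r)))).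

Definition in_openM (x : mseq) (U : dom M -> Prop) : Prop :=
  exists N, exQ (fun a => exQ (fun r =>
    mqlt mqzero r /\ in_ballM x (seq_constM a) (seq_constM r) /\
    forall n, N <= n -> U (pairM n (pairM (mcode a) (mcode r))))).

Definition IPPM : Prop := forall N c, isFunM c (fun j => j <= N) ->
  exists n, n <= N /\ InfiniteM (fun i => pairM i n IN c).

Definition OpenIntersectionsM : Prop := forall I W,
  (forall z, z IN W -> exists i u, i <= I /\ is_tripleM u /\ z = pairM i u) ->
  exists U, (forall u, u IN U -> is_tripleM u) /\
  forall X, isRealM X ->
    (in_openM (seq_ofM X) (fun u => u IN U) <->
     forall i, i <= I -> in_openM (seq_ofM X) (fun u => pairM i u IN W)).

End ModelStatement.

(** * Codes of pairs and of rationals *)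

Section Codes.
Variable M : model.
Implicit Types (a b c d i j k m n : dom M) (p q : mrat M) (x y : ratM M).
Local Notation "t \inM X" := (memM t X) (at level 70).

Lemma toq_le a b : toq a <= toq b <-> (a <= b)%M.
Proof.
rewrite le_eqVlt; split=> [/orP[/eqP/toq_inj ->|/toq_lt]|[/toq_lt ->|->]]; rewrite ?eqxx ?orbT //.
  by right.
by left.
Qed.

Lemma toq_gt0 a : (0 < toq a) <-> (0 < a)%M.
Proof. by rewrite -toq_lt. Qed.

Lemma toq_leS a b : (a < b)%M -> toq a + 1 <= toq b.
Proof. by move=> /ltM_ex[c ->]; rewrite !toqD toq1; have := toq_ge0 c; lra. Qed.

Lemma toq_pair i j : toq (pairM i j) = (toq i + toq j) * (toq i + toq j) + toq i.
Proof. by rewrite !(toqD, toqM). Qed.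

Lemma toq_int a : toq a = 0 \/ 1 <= toq a.
Proof.
have [->|/toq_leS] := zero_or_posM a; first by left.
by rewrite toq0; right; lra.
Qed.

Lemma leM_pairl i j : (i <= pairM i j)%M.
Proof. by apply/toq_le; rewrite toq_pair; have := toq_ge0 i; have := toq_ge0 j; nra. Qed.

Lemma leM_pairr i j : (j <= pairM i j)%M.
Proof.
apply/toq_le; rewrite toq_pair.
by have := toq_ge0 i; have := toq_ge0 j; have [->|] := toq_int j; nra.
Qed.

(** For sums [s < t] one has [s^2 + i <= s^2 + s < (s + 1)^2 <= t^2]. Hence a code determines the
    sum and then both components. *)
Lemma pairM_lt i j i' j' : (i + j < i' + j')%M -> (pairM i j < pairM i' j')%M.
Proof.
move/toq_leS; rewrite !toqD => ss; apply/toq_lt; rewrite !toq_pair.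
move: (toq_ge0 i) (toq_ge0 j) (toq_ge0 i') (toq_ge0 j').
set s := toq i + toq j in ss *; set t := toq i' + toq j' in ss *; move=> i0 j0 i0' j0'.
have s0 : 0 <= s by rewrite /s; lra.
have is_ : toq i <= s by rewrite /s; lra.
have : (s + 1) * (s + 1) <= t * t by nra.
by nra.
Qed.

Lemma pairM_mono i j i' j' : (i <= i')%M -> (j <= j')%M -> (pairM i j <= pairM i' j')%M.
Proof.
rewrite -!toq_le !toq_pair.
by move: (toq_ge0 i) (toq_ge0 j) (toq_ge0 i') (toq_ge0 j'); nra.
Qed.

Lemma ltM_irr a : ~ (a < a)%M.
Proof. by move/toq_lt; rewrite ltxx. Qed.

Lemma pairM_inj i j i' j' : pairM i j = pairM i' j' -> i = i' /\ j = j'.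
Proof.
move=> E.
have [/pairM_lt|[ss|/pairM_lt]] := ltM_total (i + j)%M (i' + j')%M.
- by rewrite E => /ltM_irr.
- have : toq (pairM i j) = toq (pairM i' j') by rewrite E.
  rewrite !toq_pair -!toqD ss => ii.
  have {}ii : i = i' by apply: toq_inj; lra.
  split=> //; apply: toq_inj; have : toq (i + j)%M = toq (i' + j')%M by rewrite ss.
  by rewrite !toqD ii; lra.
- by rewrite E => /ltM_irr.
Qed.

Lemma leM_trans a b c : (a <= b)%M -> (b <= c)%M -> (a <= c)%M.
Proof. by rewrite -!toq_le; exact: le_trans. Qed.

Lemma leM_refl a : (a <= a)%M.
Proof. by right. Qed.

Lemma leM_0 a : (0 <= a)%M.
Proof. by apply/toq_le; exact: toq_ge0. Qed.

Lemma leM_total a b : (a <= b)%M \/ (b <= a)%M.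
Proof. by rewrite -!toq_le; case: (leP (toq a) (toq b)) => [|/ltW]; [left|right]. Qed.

Lemma not_ltM a b : ~ (a < b)%M <-> (b <= a)%M.
Proof. by rewrite -toq_le -toq_lt leNgt; split=> [/negP|/negP]. Qed.

Lemma leM_anti a b : (a <= b)%M -> (b <= a)%M -> a = b.
Proof. by rewrite -!toq_le => ab ba; apply: toq_inj; apply: le_anti; rewrite ab. Qed.

Lemma maxM a b : exists c, (a <= c)%M /\ (b <= c)%M.
Proof. by case: (leM_total a b) => ab; [exists b|exists a]; split=> //; exact: leM_refl. Qed.

(** Without a least element, bounded induction on [n] shows that [X] has no element below [n]. *)
Lemma least_element (X : sets M) n : n \inM X ->
  exists m, m \inM X /\ forall k, k \inM X -> (m <= k)%M.
Proof.
move=> nX; apply: contrapT => noleast.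
have : forall n, forall k, (k < n)%M -> ~ (k \inM X).
  refine (@ind_bounded M ((ALL v, v < nvar 0 ===> ~ (v IN svar 0))%hf 1%N 1%N)
    (nenv [::]) (senv [:: X]) erefl _ _); cbn; first by move=> d /ltM0.
  move=> m IH k /ltMS[/IH//|->] mX; apply: noleast; exists m; split=> // k' k'X.
  by apply/not_ltM => /IH; exact.
by move/(_ (n + 1)%M n); apply => //; apply/ltMS; exact: leM_refl.
Qed.

(** [Sigma01] induction yields a common bound for all [t < n]; in the step, this bound is merely
    enlarged to cover a witness for [n]. *)
Lemma collection (X : sets M) b : (forall t, (t <= b)%M -> exists m, pairM t m \inM X) ->
  exists w, forall t, (t <= b)%M -> exists m, (m <= w)%M /\ pairM t m \inM X.
Proof.
move=> H.
have : forall n, exists w, forall t, (t < n)%M -> (t < b + 1)%M ->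
    exists m, (m < w + 1)%M /\ pairM t m \inM X.
  have := @ind_Sigma M ((ALL t, t < nvar 1 ===> t < nvar 0 + 1 ===>
      EXB v UPTO nvar 2, hpair t v IN svar 0)%hf 3%N 1%N)
    (nenv [:: b]) (senv [:: X]) erefl; cbn; apply.
    by exists 0%M => t /ltM0.
  move=> n [w IH].
  have [np|np] := EM (n <= b)%M; last first.
    exists w => t /ltMS[tn|->] tp; first exact: IH.
    by case: np; apply/ltMS.
  have [m mX] := H n np; have [v [wv mv]] := maxM w m; exists v.
  move=> t /ltMS[tn|->] tp; last by exists m; split=> //; apply/ltMS.
  have [m' [m'w m'X]] := IH t tn tp; exists m'; split=> //.
  by apply/ltMS; apply: leM_trans wv; apply/ltMS.
move/(_ (b + 1)%M) => [w Hw]; exists w => t tp.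
have tp' : (t < b + 1)%M by apply/ltMS.
by have [m [/ltMS mw mX]] := Hw t tp' tp'; exists m.
Qed.

Definition qval q : ratM M := (toq (mpos q) - toq (mneg q)) / toq (mden q).

Definition posden q : Prop := (0 < mden q)%M.

Lemma mqeqE p q : posden p -> posden q -> mqeq p q <-> qval p = qval q.
Proof.
move=> /toq_gt0 p0 /toq_gt0 q0; rewrite /mqeq /qval.
split=> [E|/eqP].
  apply/eqP; rewrite eqr_div ?lt0r_neq0 //; apply/eqP.
  by have := congr1 (@toq M) E; rewrite !(toqD, toqM); lra.
rewrite eqr_div ?lt0r_neq0 // => /eqP E; apply: toq_inj; rewrite !(toqD, toqM); lra.
Qed.

Lemma mqltE p q : posden p -> posden q -> mqlt p q <-> qval p < qval q.
Proof.
move=> /toq_gt0 p0 /toq_gt0 q0; rewrite /mqlt /qval -toq_lt !(toqD, toqM).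
rewrite ltr_pdivrMr // mulrAC ltr_pdivlMr //; split=> ?; lra.
Qed.

Lemma mqleE p q : posden p -> posden q -> mqle p q <-> qval p <= qval q.
Proof.
move=> p0 q0; rewrite /mqle mqltE // mqeqE // le_eqVlt.
by split=> [[->|->]|/orP[/eqP|]]; rewrite ?eqxx ?orbT; auto.
Qed.

Lemma qval0 : qval (mqzero M) = 0.
Proof. by rewrite /qval /= subrr mul0r. Qed.

Lemma qval_opp q : qval (mqopp q) = - qval q.
Proof. by rewrite /qval /= -mulNr opprB. Qed.

Lemma qval_add p q : posden p -> posden q -> qval (mqadd p q) = qval p + qval q.
Proof.
move=> /toq_gt0 p0 /toq_gt0 q0; rewrite /qval /= !(toqD, toqM).
by field; rewrite !lt0r_neq0.
Qed.

Lemma posden0 : posden (mqzero M).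
Proof. by apply/toq_gt0; rewrite /= toq1. Qed.

Lemma posden_add p q : posden p -> posden q -> posden (mqadd p q).
Proof. by move=> /toq_gt0 p0 /toq_gt0 q0; apply/toq_gt0; rewrite /= toqM mulr_gt0. Qed.

Lemma qval_sub p q : posden p -> posden q -> qval (mqsub p q) = qval p - qval q.
Proof. by move=> p0 q0; rewrite /mqsub qval_add // qval_opp. Qed.

Lemma posden_sub p q : posden p -> posden q -> posden (mqsub p q).
Proof. exact: posden_add. Qed.

Lemma mqisabsE p q : posden p -> posden q -> mqisabs p q <-> qval p = `|qval q|.
Proof.
move=> p0 q0; have z0 := posden0; have oq : posden (mqopp q) by [].
rewrite /mqisabs !mqleE // !mqeqE // qval0 qval_opp.
split=> [[[q1 ->]|[q1 ->]]|->].
- by rewrite ger0_norm.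
- by rewrite ler0_norm.
have [q1|] := boolP (0 <= qval q); first by left; rewrite ger0_norm.
by rewrite -ltNge => /ltW q1; right; rewrite ler0_norm.
Qed.

Lemma posden_isRat q : isRatM q -> posden q.
Proof. by case. Qed.

Lemma mcode_inj p q : mcode p = mcode q -> p = q.
Proof. by case: p q => [a b d] [a' b' d'] /pairM_inj[/pairM_inj[/= -> ->] ->]. Qed.

Lemma isRat_inj p q : isRatM p -> isRatM q -> qval p = qval q -> p = q.
Proof.
case: p q => [a b d] [a' b' d'] [p0 Hp] [q0 Hq] E; apply: mcode_inj; apply: leM_anti.
  by apply: Hp => //; apply/mqeqE.
by apply: Hq => //; apply/mqeqE.
Qed.

Lemma isRatP q : isRatM q <-> posden q /\
  forall p, posden p -> qval p = qval q -> (mcode q <= mcode p)%M.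
Proof.
split=> -[q0 H]; split=> //.
  by case=> m n d p0 E; apply: H => //; apply/mqeqE.
by move=> m n d d0 /mqeqE E; apply: H => //; exact: E.
Qed.

Lemma toqS_gt0 d : 0 < toq (d + 1)%M.
Proof. by rewrite toqD toq1; have := toq_ge0 d; lra. Qed.

(** The components of a fraction are at most its code, so the codes of fractions with value [x] form
    a set by bounded comprehension; its least element is the canonical code. *)
Lemma isRat_ex x : exists q, isRatM q /\ qval q = x.
Proof.
have [a [b [d E]]] := ratM_surj x.
pose q0 := MRat a b (d + 1)%M.
have q00 : posden q0 by apply/toq_gt0; exact: toqS_gt0.
have xq : qval q0 = x.
  by rewrite /qval /= -E toqD toq1 mulfK // gt_eqF // -toq1 -toqD toqS_gt0.
rewrite -{x E}xq.
have [X HX] := @comp_bounded M ((EXB u UPTO nvar 3, EXB v UPTO nvar 3, EXB w UPTO nvar 3,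
    nvar 3 == qcode (HRat u v w) /\ 0 < w /\
    qeq (HRat u v w) (HRat (nvar 0) (nvar 1) (nvar 2)))%hf 4%N 0%N)
  (nenv [:: (d + 1)%M; b; a]) (senv [::]) erefl.
cbn in HX.
have {}HX c : c \inM X <-> exists q, c = mcode q /\ posden q /\ qval q = qval q0.
  rewrite HX; split=> [[u [_ [v [_ [w [_ [E [w0 uvw]]]]]]]]|[[u v w] [-> [w0 E]]]].
    exists (MRat u v w); split=> //; split=> //; exact/(@mqeqE (MRat u v w) q0).
  have uv := leM_pairl u v; have vu := leM_pairr u v.
  have uvw := leM_pairl (pairM u v) w; have wuv := leM_pairr (pairM u v) w.
  exists u; split; first by apply/ltMS; apply: leM_trans uvw.
  exists v; split; first by apply/ltMS; apply: leM_trans uvw.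
  exists w; split; first by apply/ltMS.
  by split=> //; split=> //; exact/(@mqeqE (MRat u v w) q0).
have [|_ [/HX[q [-> [qd qq]]] least]] := @least_element X (mcode q0).
  by apply/HX; exists q0.
exists q; split=> //; apply/isRatP; split=> // p p0 pq.
by apply: least; apply/HX; exists p; rewrite pq.
Qed.

Definition rcode c x : Prop := exists q, isRatM q /\ c = mcode q /\ qval q = x.

Lemma rcode_inj c x y : rcode c x -> rcode c y -> x = y.
Proof. by move=> [p [_ [-> <-]]] [q [_ [/mcode_inj -> <-]]]. Qed.

Lemma rcode_fun c d x : rcode c x -> rcode d x -> c = d.
Proof. by move=> [p [pr [-> <-]]] [q [qr [-> /(isRat_inj qr pr) ->]]]. Qed.

Lemma rcode_ex x : exists c, rcode c x.
Proof. by have [q [qr qx]] := isRat_ex x; exists (mcode q), q. Qed.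

Lemma exQE (F : mrat M -> Prop) : exQ F <-> exists q, isRatM q /\ F q.
Proof. by split=> [[a [b [d H]]]|[[a b d] H]]; [exists (MRat a b d)|exists a, b, d]. Qed.

Lemma allQE (F : mrat M -> Prop) : allQ F <-> forall q, isRatM q -> F q.
Proof. by split=> [H [a b d]|H a b d]; apply: H. Qed.

(** * Reals and open sets of a model *)

(** The restriction to canonical codes treats all sequences alike: [seq_constM] and [seq_absdiffM]
    admit every fraction of the right value, whereas the set of a real contains only canonical
    codes. *)
Definition represents (s : mseq M) (xi : dom M -> ratM M) : Prop :=
  forall n q, isRatM q -> s n q <-> qval q = xi n.

Lemma represents_const q : isRatM q -> represents (seq_constM q) (fun _ => qval q).
Proof. by move=> [q0 _] n p [p0 _]; exact: mqeqE. Qed.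

Lemma represents_absdiff s t xi eta : represents s xi -> represents t eta ->
  represents (seq_absdiffM s t) (fun n => `|xi n - eta n|).
Proof.
move=> sx te n q qr; rewrite /seq_absdiffM exQE.
have [a [ar ax]] := isRat_ex (xi n); have [b [br bx]] := isRat_ex (eta n).
have [qd [ad bd]] := (posden_isRat qr, (posden_isRat ar, posden_isRat br)).
split=> [[a' [a'r /exQE[b' [b'r [/(sx _ _ a'r) sa [/(te _ _ b'r) tb]]]]]]|qx].
  have [a'd b'd] := (posden_isRat a'r, posden_isRat b'r).
  by rewrite mqisabsE ?qval_sub ?sa ?tb //; exact: posden_sub.
exists a; split=> //; apply/exQE; exists b; split=> //.
split; first exact/sx; split; first exact/te.
by rewrite mqisabsE ?qval_sub ?ax ?bx //; exact: posden_sub.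
Qed.

Lemma rleE s t xi eta : represents s xi -> represents t eta ->
  rleM s t <-> forall e, 0 < e -> exists N, forall n, (N <= n)%M -> xi n <= eta n + e.
Proof.
move=> sx te; rewrite /rleM allQE; split=> [H e e0|H q qr].
  have [q [qr qe]] := isRat_ex e; have qd := posden_isRat qr.
  have [|N HN] := H q qr; first by apply/mqltE; rewrite ?qval0 ?qe //; exact: posden0.
  exists N => n /HN /allQE HN'.
  have [a [ar ax]] := isRat_ex (xi n); have [b [br bx]] := isRat_ex (eta n).
  move: (HN' a ar) => /allQE/(_ b br); rewrite sx // te // mqleE ?qval_add ?ax ?bx ?qe //;
    try exact: posden_isRat; last exact: posden_add (posden_isRat _) _.
  exact.
have qd := posden_isRat qr; rewrite mqltE ?qval0 //; last exact: posden0.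
move=> /H[N HN]; exists N => n /HN le; apply/allQE => a ar; apply/allQE => b br.
rewrite sx // te // => ax bx.
have [ad bd] := (posden_isRat ar, posden_isRat br).
by rewrite mqleE ?qval_add ?ax ?bx //; exact: posden_add.
Qed.

Definition cauchy (xi : dom M -> ratM M) : Prop :=
  forall e, 0 < e -> exists N, forall m n, (N <= m)%M -> (N <= n)%M -> `|xi m - xi n| < e.

Lemma CauchyE s xi : represents s xi -> CauchyM s <-> cauchy xi.
Proof.
move=> sx; rewrite /CauchyM allQE; split=> [H e e0|H q qr].
  have [q [qr qe]] := isRat_ex e; have qd := posden_isRat qr.
  have [|N HN] := H q qr; first by apply/mqltE; rewrite ?qval0 ?qe //; exact: posden0.
  exists N => m n Nm Nn; move: (HN m n Nm Nn) => /allQE HN'.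
  have [a [ar ax]] := isRat_ex (xi m); have [b [br bx]] := isRat_ex (xi n).
  have [d [dr dx]] := isRat_ex `|xi m - xi n|.
  have [ad [bd dd]] := (posden_isRat ar, (posden_isRat br, posden_isRat dr)).
  move: (HN' a ar) => /allQE/(_ b br)/allQE/(_ d dr).
  rewrite !sx // mqisabsE ?qval_sub ?ax ?bx ?dx ?mqltE ?dx ?qe //; last exact: posden_sub.
  exact.
have qd := posden_isRat qr; rewrite mqltE ?qval0 //; last exact: posden0.
move=> /H[N HN]; exists N => m n Nm Nn; apply/allQE => a ar; apply/allQE => b br.
apply/allQE => d dr; have [ad [bd dd]] := (posden_isRat ar, (posden_isRat br, posden_isRat dr)).
rewrite !sx // mqisabsE ?qval_sub // => [ax bx dx|]; last exact: posden_sub.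
by rewrite mqltE // dx ax bx; exact: HN.
Qed.

(** The function [xi] is chosen outside the model; the last clause links it to the set [X], which
    comprehension can refer to. *)
Lemma isReal_represents X : isRealM X -> exists xi,
  [/\ cauchy xi, represents (seq_ofM X) xi & forall n c, pairM n c \inM X <-> rcode c (xi n)].
Proof.
move=> [[Xrat Xfun] Xc].
have ex n : exists x, exists c, pairM n c \inM X /\ rcode c x.
  have [c [cX _]] := Xfun n.
  have [_ [_ [/exQE[q [qr ->]] /pairM_inj[_ E]]]] := Xrat _ cX.
  by exists (qval q), c; split=> //; exists q.
pose xi n := projT1 (cid (ex n)); exists xi.
have xiP n : exists c, pairM n c \inM X /\ rcode c (xi n) := projT2 (cid (ex n)).
have key n c : pairM n c \inM X <-> rcode c (xi n).
  have [c' [c'X c'x]] := xiP n; split=> [cX|cx].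
    by have [k [_ uniq_]] := Xfun n; rewrite (uniq_ c) // -(uniq_ c').
  by rewrite (rcode_fun cx c'x).
have rep : represents (seq_ofM X) xi.
  move=> n q qr; rewrite /seq_ofM key; split=> [H|<-]; last by exists q.
  by apply: (@rcode_inj (mcode q)) => //; exists q.
by split=> //; exact/(CauchyE rep).
Qed.

(** Failure of the converse inequality provides a gap [e] at arbitrarily late entries. As the
    sequence is Cauchy, late entries differ by less than [e / 2], and a gap of [e / 2] remains at
    all of them. *)
Lemma in_ballE s xi (a r : mrat M) : represents s xi -> cauchy xi -> isRatM a -> isRatM r ->
  in_ballM s (seq_constM a) (seq_constM r) <->
  exists e, 0 < e /\ exists N, forall n, (N <= n)%M -> `|xi n - qval a| + e <= qval r.
Proof.
move=> sx xc ar rr; have sa := represents_absdiff (represents_const ar) sx.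
have sr := represents_const rr.
rewrite /in_ballM /rltM (rleE sa sr) (rleE sr sa); split=> [[le nge]|[e [e0 [N HN]]]].
- have [e [e0 He]] : exists e, 0 < e /\ forall N, exists n, (N <= n)%M /\
      `|qval a - xi n| + e < qval r.
    apply: contrapT => H; apply: nge; split=> // e e0; apply: contrapT => H'.
    apply: H; exists e; split=> // N; apply: contrapT => H''; apply: H'; exists N => n Nn.
    by rewrite leNgt; apply/negP => lt; apply: H''; exists n.
  exists (e / 2); split; first by lra.
  have [|N HN] := xc (e / 2); first by lra.
  have [n [Nn Hn]] := He N; exists N => m Nm; have := HN m n Nm Nn.
  have := ler_distD (xi n) (xi m) (qval a); rewrite distrC in Hn; lra.
split=> [e' e'0|[_ ge]].
  by exists N => n /HN; rewrite distrC; lra.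
have [|N' HN'] := ge (e / 2); first by lra.
have [n [Nn N'n]] := maxM N N'; have := HN n Nn; have := HN' n N'n; rewrite distrC; lra.
Qed.

Definition inside (xi : dom M -> ratM M) (b s : ratM M) : Prop :=
  exists e, 0 < e /\ exists N, forall n, (N <= n)%M -> `|xi n - b| + e <= s.

Lemma in_openE s xi (U : dom M -> Prop) : represents s xi -> cauchy xi ->
  in_openM s U <-> exists (N : dom M) (b r : ratM M) (c d : dom M),
    [/\ rcode c b, rcode d r, 0 < r, inside xi b r &
    forall n, (N <= n)%M -> U (pairM n (pairM c d))].
Proof.
move=> sx xc; split=> [[N /exQE[a [ar /exQE[r [rr [r0 [ball HN]]]]]]]|].
  exists N, (qval a), (qval r), (mcode a), (mcode r); split=> //.
  - by exists a.
  - by exists r.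
  - move: r0; rewrite mqltE ?qval0 //; first exact: posden0.
    exact: posden_isRat.
  - exact/(in_ballE sx xc ar rr).
move=> [N [b [r [_ [_ [[a [ar [-> <-]]] [q [qr [-> <-]]] r0 ball HN]]]]]].
exists N; apply/exQE; exists a; split=> //; apply/exQE; exists q; split=> //; split.
  by rewrite mqltE ?qval0 //; [exact: posden0|exact: posden_isRat].
by split=> //; apply/(in_ballE sx xc ar qr).
Qed.

Lemma is_tripleE u : is_tripleM u <->
  exists (n : dom M) (b r : ratM M) (c d : dom M),
  [/\ rcode c b, rcode d r, 0 < r & u = pairM n (pairM c d)].
Proof.
split=> [[n /exQE[a [ar /exQE[r [rr [r0 ->]]]]]]|].
  exists n, (qval a), (qval r), (mcode a), (mcode r); split=> //.
  - by exists a.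
  - by exists r.
  - move: r0; rewrite mqltE ?qval0 //; first exact: posden0.
    exact: posden_isRat.
move=> [n [b [r [_ [_ [[a [ar [-> _]]] [q [qr [-> <-]]] r0 ->]]]]]].
exists n; apply/exQE; exists a; split=> //; apply/exQE; exists q; split=> //; split=> //.
by rewrite mqltE ?qval0 //; [exact: posden0|exact: posden_isRat].
Qed.

End Codes.

(** * From intersections to the pigeonhole principle *)

Section IntersectionsToPigeonhole.
Variable M : model.
Local Notation "t \inM X" := (memM t X) (at level 70).

Lemma leM_pairl_trans (a i j : dom M) : (a <= i)%M -> (a <= pairM i j)%M.
Proof. by move=> ai; apply: leM_trans ai (leM_pairl _ _). Qed.

Lemma leM_pairr_trans (a i j : dom M) : (a <= j)%M -> (a <= pairM i j)%M.
Proof. by move=> aj; apply: leM_trans aj (leM_pairr _ _). Qed.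

Lemma ltMS_le (a b : dom M) : (a <= b)%M -> (a < b + 1)%M.
Proof. by move/ltMS. Qed.

Lemma inv_gt0 (p : dom M) : 0 < 1 / (toq p + 1).
Proof. by apply: divr_gt0 => //; have := toq_ge0 p; lra. Qed.

Lemma inv_le (p q : dom M) : (p <= q)%M -> 1 / (toq q + 1) <= 1 / (toq p + 1).
Proof.
move/toq_le => pq; have p0 := toq_ge0 p.
by rewrite !mul1r lef_pV2 ?posrE; lra.
Qed.

(** If [e = (a - b) / d] is positive, then [a - b >= 1] by discreteness, so the denominator [d] can
    serve as [p]. *)
Lemma archimedean (e : ratM M) : 0 < e -> exists p : dom M, 1 / (toq p + 1) <= e.
Proof.
move=> e0; have [[a b d] [/posden_isRat/toq_gt0 /= d0 E]] := isRat_ex e.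
exists d; rewrite ler_pdivrMr; last by lra.
have {}E : toq a - toq b = e * toq d by rewrite -E /qval /= divfK // lt0r_neq0.
have : toq b + 1 <= toq a.
  apply: toq_leS; apply/toq_lt; rewrite -subr_gt0 E; exact: mulr_gt0.
by nra.
Qed.

Definition code0 : dom M := pairM (pairM 0%M 0%M) 1%M.
Definition code_inv (p : dom M) : dom M := pairM (pairM 1%M 0%M) (p + 1)%M.

Lemma pos_geS (d : dom M) : (0 < d)%M -> 1 <= toq d.
Proof. by move/toq_leS; rewrite toq0 add0r. Qed.

Lemma rcode0 : rcode code0 0.
Proof.
exists (mqzero M); split; last by split=> //; exact: qval0.
apply/isRatP; split; first exact: posden0.
move=> [a b d] /pos_geS d1 _; apply: pairM_mono; last by apply/toq_le; rewrite toq1.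
by apply: pairM_mono; exact: leM_0.
Qed.

(** A fraction [(a - b) / d] with this value has [a >= 1] and [d >= p + 1]; since pairing is
    monotone, the code is least. *)
Lemma rcode_code_inv p : rcode (code_inv p) (1 / (toq p + 1)).
Proof.
have p0 := toq_ge0 p.
pose q := MRat 1%M 0%M (p + 1)%M.
have qv : qval q = 1 / (toq p + 1) by rewrite /qval /= !(toqD, toq1, toq0) subr0.
exists q; split=> //; apply/isRatP; split; first by apply/toq_gt0; exact: toqS_gt0.
move=> [a b d] /pos_geS /= d1; rewrite qv /qval /= => /eqP.
rewrite eqr_div ?lt0r_neq0 //; [|lra|lra] => /eqP E.
have ab : toq b + 1 <= toq a.
  by apply: toq_leS; apply/toq_lt; rewrite ltNge; apply/negP => ab; nra.
apply: pairM_mono; last by apply/toq_le; rewrite toqD toq1; nra.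
apply: pairM_mono; last exact: leM_0.
by apply/toq_le; rewrite toq1; have := toq_ge0 b; lra.
Qed.

Lemma code_inv_inj p q : code_inv p = code_inv q -> p = q.
Proof. by move=> /pairM_inj[_]; exact: succM_inj. Qed.

Lemma const_real (x : ratM M) :
  exists X, isRealM X /\ represents (seq_ofM X) (fun _ => x).
Proof.
have [c cx] := rcode_ex x; have [q [qr [cq qx]]] := cx.
have [X HX] := @comp_bounded M ((EXB u UPTO nvar 1, nvar 1 == hpair u (nvar 0))%hf 2%N 0%N)
  (nenv [:: c]) (senv [::]) erefl.
cbn in HX.
have {}HX z : z \inM X <-> exists n, z = pairM n c.
  rewrite HX; split=> [[n [_ ->]]|[n ->]]; exists n => //.
  by split=> //; apply: ltMS_le; exact: leM_pairl.
have rep : represents (seq_ofM X) (fun _ => x).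
  move=> n p pr; rewrite /seq_ofM HX; split=> [[m /pairM_inj[_]]|px].
    by rewrite cq => /mcode_inj ->.
  by exists n; rewrite cq; congr (pairM _ (mcode _)); apply: isRat_inj; rewrite // px.
exists X; split=> //; split; last first.
  apply/(CauchyE rep) => e e0; exists 0%M => *; by rewrite subrr normr0.
split=> [z /HX[n ->]|n].
  by exists n, c; split=> //; apply/exQE; exists q.
by exists c; split; [apply/HX; exists n|move=> k /HX[m /pairM_inj[]]].
Qed.

Lemma cauchy_const (x : ratM M) : cauchy (fun _ : dom M => x).
Proof. by move=> e e0; exists 0%M => *; rewrite subrr normr0. Qed.

Theorem intersections_imply_IPP : OpenIntersectionsM M -> IPPM M.
Proof.
move=> OI N c [crange cfun]; apply: contrapT => noinf.
have fin n : (n <= N)%M -> exists k, forall i, (k <= i)%M -> ~ pairM i n \inM c.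
  move=> nN; apply: contrapT => H; apply: noinf; exists n; split=> // k.
  by apply: contrapT => H'; apply: H; exists k => i ki ic; apply: H'; exists i.
have [W HW] := @comp_bounded M ((EXB u UPTO nvar 1, EXB v UPTO nvar 1, EXB w UPTO nvar 1,
    nvar 1 == hpair u (hpair v (hpair (qcode qzero) (qcode (HRat 1 0 (w + 1))))) /\
    u <= nvar 0 /\ ALLB t UPTO v, (w <= t ===> ~ (hpair t u IN svar 0)))%hf 2%N 1%N)
  (nenv [:: N]) (senv [:: c]) erefl.
cbn in HW.
have {}HW z : z \inM W <-> exists n k q,
    [/\ z = pairM n (pairM k (pairM code0 (code_inv q))), (n <= N)%M &
      forall j, (j <= k)%M -> (q <= j)%M -> ~ pairM j n \inM c].
  rewrite HW; split=> [|[n [k [q [-> nN H]]]]].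
    move=> [n [_ [k [_ [q [_ [-> [nN H]]]]]]]]; exists n, k, q; split=> // j jk.
    by apply: H; apply: ltMS_le.
  exists n; split; first by apply: ltMS_le; exact: leM_pairl.
  exists k; split; first by apply: ltMS_le; apply: leM_pairr_trans; exact: leM_pairl.
  exists q; split.
    apply: ltMS_le; do 3! apply: leM_pairr_trans; apply: leM_pairr_trans.
    by apply/toq_le; rewrite toqD toq1; lra.
  by split=> //; split=> // j /ltMS; exact: H.
have [|U [_ HU]] := OI N W.
  move=> z /HW[n [k [q [-> nN _]]]]; exists n, (pairM k (pairM code0 (code_inv q))).
  split=> //; split=> //; apply/is_tripleE; exists k, 0, (1 / (toq q + 1)), code0, (code_inv q).
  by split=> //; [exact: rcode0|exact: rcode_code_inv|exact: inv_gt0].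
have [X [Xr Xrep]] := const_real 0.
have : in_openM (seq_ofM X) (fun u => u \inM U).
  apply/HU => // n nN; apply/(in_openE _ Xrep); first exact: cauchy_const.
  have [k Hk] := fin n nN.
  exists k, 0, (1 / (toq k + 1)), code0, (code_inv k); split.
  - exact: rcode0.
  - exact: rcode_code_inv.
  - exact: inv_gt0.
  - exists (1 / (toq k + 1)); split; first exact: inv_gt0.
    by exists 0%M => *; rewrite subrr normr0 add0r.
  - by move=> m km; apply/HW; exists n, m, k; split=> // j _; exact: Hk.
case/(in_openE _ Xrep); first exact: cauchy_const.
move=> L [b [r [cb [cr [cbb crr r0 [e [e0 [L' HL']]] HL]]]]].
(* The ball around [b] contains 0 with margin [e], so it contains each point at distance at most
   [e / 2] from 0 with margin [e / 2]. *)
have [q qe] : exists q : dom M, 1 / (toq q + 1) <= e / 2 by apply: archimedean; lra.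
have [Y [Yr Yrep]] := const_real (1 / (toq q + 1)).
have YU : in_openM (seq_ofM Y) (fun u => u \inM U).
  apply/(in_openE _ Yrep); first exact: cauchy_const.
  exists L, b, r, cb, cr; split=> //; exists (e / 2); split; first by lra.
  exists 0%M => _ _; have := HL' L' (leM_refl _); rewrite sub0r normrN.
  have := ler_normB (1 / (toq q + 1)) b.
  by rewrite (ger0_norm (ltW (inv_gt0 q))); lra.
have [n [qn _]] := cfun q.
have nN : (n <= N)%M by have [i [j [jN /pairM_inj[_ ->]]]] := crange _ qn.
have /(in_openE _ Yrep) := (HU Y Yr).1 YU n nN; case; first exact: cauchy_const.
move=> K [b' [r' [cb' [cr' [cbb' crr' _ [e' [e'0 [K' HK']]] HK]]]]].
(* At a stage beyond [K] the ball belongs to the code for the colour [n] of [q]; beyond [q], its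
   condition also speaks about [c(q)], provided that [q' <= q]. This holds since the radius exceeds
   [1 / (q + 1)]. *)
have [m [Km qm]] := maxM K q.
have /HW[n' [m' [q' [/pairM_inj[<- /pairM_inj[<- /pairM_inj[Eb Er]]] _ Hj]]]] := HK m Km.
apply: (Hj q) => //; apply/not_ltM => qq'.
rewrite Eb in cbb'; rewrite Er in crr'.
have b'0 := rcode_inj cbb' rcode0; have r'q := rcode_inj crr' (rcode_code_inv q').
have := HK' K' (leM_refl _); rewrite b'0 r'q subr0 (ger0_norm (ltW (inv_gt0 q))).
by have := inv_le (or_introl qq' : (q <= q')%M); lra.
Qed.

End IntersectionsToPigeonhole.

(** * From the pigeonhole principle to intersections *)

Section PigeonholeToIntersections.
Variable M : model.
Local Notation "t \inM X" := (memM t X) (at level 70).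

(** A form of [IPP] in which [p] may have several colours [i], each with evidence [v]. The least
    pair of colour and evidence for each [p], collected in [L], turns this into a function. *)
Lemma pigeonhole_choice (I : dom M) (B : sets M) : IPPM M ->
  (forall z, z \inM B -> exists p i v, (i <= I)%M /\ z = pairM p (pairM i v)) ->
  (forall p, exists y, pairM p y \inM B) ->
  exists2 i, (i <= I)%M & forall k, exists p v, (k <= p)%M /\ pairM p (pairM i v) \inM B.
Proof.
move=> ipp Bform Btot.
have [L HL] := @comp_bounded M ((EXB u UPTO nvar 0, EXB v UPTO nvar 0,
    nvar 0 == hpair u v /\ nvar 0 IN svar 0 /\
    ALL w, w < v ===> ~ hpair u w IN svar 0)%hf 1%N 1%N)
  (nenv [::]) (senv [:: B]) erefl.
cbn in HL.
have {}HL p y : pairM p y \inM L <->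
    pairM p y \inM B /\ forall y', (y' < y)%M -> ~ pairM p y' \inM B.
  rewrite HL; split=> [[u [_ [v [_ [/pairM_inj[<- <-] H]]]]]|[yB H]] //.
  exists p; split; first by apply: ltMS_le; exact: leM_pairl.
  by exists y; split=> //; apply: ltMS_le; exact: leM_pairr.
have Ltot p : exists2 y, pairM p y \inM L & forall y', pairM p y' \inM L -> y' = y.
  have [S HS] := @comp_bounded M ((hpair (nvar 0) (nvar 1) IN svar 0)%hf 2%N 1%N)
    (nenv [:: p]) (senv [:: B]) erefl.
  cbn in HS.
  have [y yB] := Btot p; have [|m [/HS mB least]] := @least_element M S y; first exact/HS.
  have mL : pairM p m \inM L.
    by apply/HL; split=> // y' y'm /HS/least; exact/not_ltM.
  exists m => // y' /HL[y'B y'least]; apply: leM_anti.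
    by apply/not_ltM => my'; exact: y'least my' mB.
  by apply: least; apply/HS.
have Lform p y : pairM p y \inM L -> exists i v, (i <= I)%M /\ y = pairM i v.
  move=> /HL[/Bform[_ [i [v [iI /pairM_inj[_ ->]]]]] _]; by exists i, v.
(* The evidence is not bounded by the colour, so [Delta01] comprehension is used. The [Pi01] form
   says that every pair that [L] assigns to [p] has the colour [i], which is equivalent as there is
   exactly one. *)
have [C HC] : exists C, forall z, z \inM C <->
    exists w p i, z = pairM p i /\ pairM p (pairM i w) \inM L.
  have [|C HC] := @comp_Delta M
    ((EXB u UPTO nvar 0, EXB v UPTO nvar 0,
      nvar 0 == hpair u v /\ hpair u (hpair v (nvar 1)) IN svar 0)%hf 2%N 1%N)
    ((EXB u UPTO nvar 0, EXB v UPTO nvar 0, nvar 0 == hpair u v /\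
      ALLB x UPTO nvar 1, ALLB y UPTO nvar 1,
        (nvar 1 == hpair x y ===> hpair u (nvar 1) IN svar 0 ===> x == v))%hf 2%N 1%N)
    (nenv [::]) (senv [:: L]) erefl erefl; cbn.
    move=> z; split=> [[w [p [pz [i [iz [E pL]]]]]] w'|].
      exists p; split=> //; exists i; split=> //; split=> // x _ y _ -> pL'.
      have [y0 _ uniq_] := Ltot p.
      have xy : pairM x y = y0 := uniq_ _ pL'.
      have iw : pairM i w = y0 := uniq_ _ pL.
      by have [] := pairM_inj (etrans xy (esym iw)).
    (* The instance at 0 serves only to decode [z] as a pair; the instance at the actual entry [y]
       of [L] gives the colour. *)
    move=> H; have [p [_ [i [_ [E _]]]]] := H 0%M.
    have [y yL _] := Ltot p; have [j [v [_ yE]]] := Lform _ _ yL.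
    have [p' [p'z [i' [i'z [E' H']]]]] := H y.
    have [pp ii] : p' = p /\ i' = i := pairM_inj (etrans (esym E') E).
    have jy : (j < y + 1)%M by rewrite yE; apply: ltMS_le; exact: leM_pairl.
    have vy : (v < y + 1)%M by rewrite yE; apply: ltMS_le; exact: leM_pairr.
    have ji : j = i by rewrite -ii; apply: (H' j jy v vy yE); rewrite pp.
    exists v, p; split; first by rewrite -pp.
    exists i; split; first by rewrite -ii.
    by split=> //; move: yL; rewrite yE ji.
  cbn in HC; exists C => z; rewrite HC; split.
    by move=> [w [p [_ [i [_ [E pL]]]]]]; exists w, p, i.
  move=> [w [p [i [-> pL]]]]; exists w, p.
  split; first by apply: ltMS_le; exact: leM_pairl.
  by exists i; split=> //; apply: ltMS_le; exact: leM_pairr.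
have [|i [iI Hi]] := ipp I C.
  split=> [z /HC[w [p [i [-> pL]]]]|p].
    exists p, i; split=> //.
    by have [j [v [jI /pairM_inj[-> _]]]] := Lform _ _ pL.
  have [y yL uniq_] := Ltot p; have [i [v [_ yE]]] := Lform _ _ yL.
  exists i; split; first by apply/HC; exists v, p, i; rewrite -yE.
  move=> k /HC[w [p' [i' [/pairM_inj[<- <-] pL]]]].
  by have [] := pairM_inj (etrans (uniq_ _ pL) yE).
exists i => // k; have [p [kp /HC[v [p' [i' [/pairM_inj[<- <-] pL]]]]]] := Hi k.
by exists p, v; split=> //; have /HL[] := pL.
Qed.

Ltac leM_component := solve
  [ exact: leM_refl
  | apply: leM_pairl_trans; leM_component
  | apply: leM_pairr_trans; leM_component ].

Ltac bounded_witness v := exists v; split; first by (apply: ltMS_le; leM_component).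

(** Minimality of a code needs to be tested only against smaller codes, whose components are smaller
    as well, so bounded quantifiers suffice. *)
Lemma rcode_set : exists R : sets M, forall c, c \inM R <-> exists x, rcode c x.
Proof.
have [R HR] := @comp_bounded M ((EXB u UPTO nvar 0, EXB v UPTO nvar 0, EXB w UPTO nvar 0,
    nvar 0 == qcode (HRat u v w) /\ 0 < w /\
    ALLB u' UPTO nvar 0, ALLB v' UPTO nvar 0, ALLB w' UPTO nvar 0,
      (0 < w' ===> qeq (HRat u' v' w') (HRat u v w) ===>
       nvar 0 <= qcode (HRat u' v' w')))%hf 1%N 0%N)
  (nenv [::]) (senv [::]) erefl.
cbn in HR; exists R => c; rewrite HR; split.
  move=> [u [_ [v [_ [w [_ [E [w0 H]]]]]]]].
  exists (qval (MRat u v w)), (MRat u v w); split=> //; split=> // u' v' w' w'0 E'.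
  have [le|le] := leM_total c (mcode (MRat u' v' w')); first by rewrite -[mcode (MRat u v w)]E.
  rewrite -[mcode (MRat u v w)]E; apply: (H u' _ v' _ w' _ w'0 E'); apply: ltMS_le;
    apply: leM_trans le.
  - by apply: leM_pairl_trans; exact: leM_pairl.
  - by apply: leM_pairl_trans; exact: leM_pairr.
  - exact: leM_pairr.
move=> [x [[u v w] [[w0 H] [-> _]]]].
exists u; split; first by apply: ltMS_le; apply: leM_pairl_trans; exact: leM_pairl.
exists v; split; first by apply: ltMS_le; apply: leM_pairl_trans; exact: leM_pairr.
exists w; split; first by apply: ltMS_le; exact: leM_pairr.
by split=> //; split=> // u' _ v' _ w' _; exact: H.
Qed.

(** The inequality ensures that the ball of radius [1 / (p + 1)] around [x] is included in that of
    radius [s] around [b]. In the bounded formula, two inequalities without absolute value replace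
    it. *)
Lemma ball_inclusion_set : exists D : sets M, forall p z x c b d s,
  rcode z x -> rcode c b -> rcode d s ->
  pairM p (pairM z (pairM c d)) \inM D <-> `|x - b| + 1 / (toq p + 1) <= s.
Proof.
have [D HD] := @comp_bounded M ((EXB p UPTO nvar 0,
    EXB x1 UPTO nvar 0, EXB x2 UPTO nvar 0, EXB x3 UPTO nvar 0,
    EXB b1 UPTO nvar 0, EXB b2 UPTO nvar 0, EXB b3 UPTO nvar 0,
    EXB s1 UPTO nvar 0, EXB s2 UPTO nvar 0, EXB s3 UPTO nvar 0,
    nvar 0 == hpair p (hpair (qcode (HRat x1 x2 x3))
      (hpair (qcode (HRat b1 b2 b3)) (qcode (HRat s1 s2 s3)))) /\
    qle (qadd (qsub (HRat x1 x2 x3) (HRat b1 b2 b3)) (HRat 1 0 (p + 1))) (HRat s1 s2 s3) /\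
    qle (qadd (qsub (HRat b1 b2 b3) (HRat x1 x2 x3)) (HRat 1 0 (p + 1))) (HRat s1 s2 s3))%hf
    1%N 0%N) (nenv [::]) (senv [::]) erefl.
cbn in HD; exists D => p z x c b d s.
move=> [X [/posden_isRat X0 [-> <-]]] [B [/posden_isRat B0 [-> <-]]] [S [/posden_isRat S0 [-> <-]]].
pose P := MRat 1%M 0%M (p + 1)%M; have P0 : posden P by apply/toq_gt0; exact: toqS_gt0.
have Pv : qval P = 1 / (toq p + 1) by rewrite /qval /= !(toqD, toq1, toq0) subr0.
have key : `|qval X - qval B| + 1 / (toq p + 1) <= qval S <->
    mqle (mqadd (mqsub X B) P) S /\ mqle (mqadd (mqsub B X) P) S.
  have [XB BX] := (posden_sub X0 B0, posden_sub B0 X0).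
  rewrite !mqleE ?qval_add ?qval_opp ?Pv //; try exact: posden_add.
  have nXB := ler_norm (qval X - qval B); have nBX := ler_norm (qval B - qval X).
  rewrite distrC in nBX; split=> [H|[H1 H2]]; first by split; lra.
  by rewrite -lerBrDr ler_norml; apply/andP; split; lra.
rewrite key HD; split.
  move=> [p' [_ [x1 [_ [x2 [_ [x3 [_ [b1 [_ [b2 [_ [b3 [_ [s1 [_ [s2 [_ [s3 [_ [E H]]]]]]]]]]]]]]]]]]]]].
  have [pE E1] := pairM_inj E; rewrite -pE in H.
  have [E2 E3] := pairM_inj E1; have [E4 E5] := pairM_inj E3.
  by rewrite (@mcode_inj M X (MRat x1 x2 x3) E2) (@mcode_inj M B (MRat b1 b2 b3) E4)
    (@mcode_inj M S (MRat s1 s2 s3) E5).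
move: X B S {X0 B0 S0 key} => [x1 x2 x3] [b1 b2 b3] [s1 s2 s3] H.
bounded_witness p; bounded_witness x1; bounded_witness x2; bounded_witness x3.
bounded_witness b1; bounded_witness b2; bounded_witness b3.
by bounded_witness s1; bounded_witness s2; bounded_witness s3.
Qed.

Lemma inv_half (p : dom M) : 1 / (toq (p + p + 1)%M + 1) = 1 / (toq p + 1) / 2.
Proof.
have p0 := toq_ge0 p; rewrite !(toqD, toq1).
by field; rewrite !lt0r_neq0 //; lra.
Qed.

Theorem IPP_implies_intersections : IPPM M -> OpenIntersectionsM M.
Proof.
move=> ipp I W Wform; have [R HR] := rcode_set; have [D HD] := ball_inclusion_set.
have [U HU] := @comp_bounded M ((EXB u UPTO nvar 1, EXB v UPTO nvar 1, EXB w UPTO nvar 1,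
    nvar 1 == hpair u (hpair v (qcode (HRat 1 0 (w + 1)))) /\ v IN svar 0 /\
    ALLB i UPTO nvar 0, EXB t UPTO w, hpair w (hpair v t) IN svar 1 /\
      ALLB x UPTO u, (w <= x ===> hpair i (hpair x t) IN svar 2))%hf 2%N 3%N)
  (nenv [:: I]) (senv [:: W; D; R]) erefl.
cbn in HU.
have {}HU u : u \inM U <-> exists n a p, [/\ u = pairM n (pairM a (code_inv p)), a \inM R &
    forall i, (i <= I)%M -> exists t, [/\ (t <= p)%M, pairM p (pairM a t) \inM D &
      forall m, (m <= n)%M -> (p <= m)%M -> pairM i (pairM m t) \inM W]].
  rewrite HU; split.
    move=> [n [_ [a [_ [p [_ [E [aR H]]]]]]]]; exists n, a, p; split=> // i /ltMS iI.
    have [t [/ltMS tp [tD tW]]] := H i iI; exists t; split=> // m /ltMS; exact: tW.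
  move=> [n [a [p [-> aR H]]]]; bounded_witness n; bounded_witness a.
  exists p; split.
    apply: ltMS_le; do 3! apply: leM_pairr_trans.
    by apply/toq_le; rewrite toqD toq1; lra.
  split=> //; split=> // i /ltMS/H[t [tp tD tW]]; exists t; split; first exact: ltMS_le.
  by split=> // m /ltMS; exact: tW.
exists U; split.
  move=> u /HU[n [a [p [-> /HR[x ax] _]]]]; apply/is_tripleE.
  exists n, x, (1 / (toq p + 1)), a, (code_inv p).
  by split=> //; [exact: rcode_code_inv|exact: inv_gt0].
move=> X /isReal_represents[xi [xc xrep xX]].
split.
- case/(in_openE _ xrep xc) => N [b [r [c [d [cb dr r0 [e [e0 [N' HN']]] HN]]]]] i iI.
  have /HU[n0 [a0 [p [/pairM_inj[_ /pairM_inj[ca dp]] _ _]]]] := HN N (leM_refl _).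
  have rp : r = 1 / (toq p + 1).
    by apply: (rcode_inj dr); rewrite dp; exact: rcode_code_inv.
  have {}HN n : (N <= n)%M -> exists t, [/\ (t <= p)%M, pairM p (pairM c t) \inM D &
      forall m, (m <= n)%M -> (p <= m)%M -> pairM i (pairM m t) \inM W].
    move=> /HN /HU[n' [a' [p' [/pairM_inj[<- /pairM_inj[<- E]] _ H]]]].
    by rewrite dp in E; rewrite (code_inv_inj E); exact: H.
  have [t [tp tD tW]] : exists t, [/\ (t <= p)%M, pairM p (pairM c t) \inM D &
      forall m, (p <= m)%M -> pairM i (pairM m t) \inM W].
    (* Otherwise each [t <= p] fails at some stage. By collection, a single [w] bounds such stages
       for all [t], which contradicts [HN] at a stage beyond [w]. *)
    apply: contrapT => not.
    have [B HB] := @comp_bounded M ((EXB t UPTO nvar 3, EXB m UPTO nvar 3,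
        nvar 3 == hpair t m /\ (~ (hpair (nvar 1) (hpair (nvar 2) t) IN svar 0) \/
          (nvar 1 <= m /\ ~ (hpair (nvar 0) (hpair m t) IN svar 1))))%hf 4%N 2%N)
      (nenv [:: c; p; i]) (senv [:: W; D]) erefl.
    cbn in HB.
    have {}HB t m : pairM t m \inM B <-> ~ (pairM p (pairM c t) \inM D) \/
        ((p <= m)%M /\ ~ (pairM i (pairM m t) \inM W)).
      rewrite HB; split=> [[t' [_ [m' [_ [E H]]]]]|H].
        by have [-> ->] := pairM_inj E.
      by bounded_witness t; bounded_witness m.
    have [|w Hw] := @collection M B p.
      move=> t tp; apply: contrapT => nB; apply: not; exists t; split=> //.
        (* If [t] fails the inclusion, the stage is irrelevant and 0 is a default. *)
        by apply: contrapT => tD; apply: nB; exists 0%M; apply/HB; left.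
      move=> m pm; apply: contrapT => mW; apply: nB; exists m; apply/HB; right.
      by split.
    have [n [Nn wn]] := maxM N w.
    have [t [tp tD tW]] := HN n Nn; have [m [mw /HB[//|[pm nW]]]] := Hw t tp.
    by apply: nW; apply: tW pm; exact: leM_trans mw wn.
  (* Membership at stage [p] reveals that [t] codes a ball; its inclusion of the ball around [b]
     preserves the margin [e]. *)
  have [j [u [_ [/is_tripleE[m [b' [r' [c' [d' [cb' dr' r'0 ->]]]]]] /pairM_inj[_]]]]] :=
    Wform _ (tW p (leM_refl _)).
  move=> /pairM_inj[_ tE]; rewrite tE in tD tW.
  have /HD := tD; move=> /(_ _ _ _ cb cb' dr'); rewrite -rp => inc.
  apply/(in_openE _ xrep xc); exists p, b', r', c', d'; split=> //.
  exists e; split=> //; exists N' => n /HN'.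
  by have := ler_distD b (xi n) b'; lra.
move=> xU.
have [p Hp] : exists p, forall i, (i <= I)%M -> exists2 t, (t <= p)%M &
    forall m, (p <= m)%M -> pairM i (pairM m t) \inM W /\
      forall z, pairM m z \inM X -> pairM p (pairM z t) \inM D.
  apply: contrapT => not.
  have [B HB] := @comp_bounded M ((EXB p UPTO nvar 1, EXB i UPTO nvar 1, EXB w UPTO nvar 1,
      nvar 1 == hpair p (hpair i w) /\ i <= nvar 0 /\
      ALLB t UPTO p, EXB m UPTO w, EXB z UPTO w, p <= m /\
        (~ (hpair i (hpair m t) IN svar 0) \/
         (hpair m z IN svar 1 /\ ~ (hpair p (hpair z t) IN svar 2))))%hf 2%N 3%N)
    (nenv [:: I]) (senv [:: D; X; W]) erefl.
  cbn in HB.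
  (* At some [m >= p], either the ball coded by [t] is missing from the code of [U_i], or it is not
     certified to include the ball of radius [1 / (p + 1)] around the entry [z] of the real. *)
  pose bad p i m z t := (p <= m)%M /\ (~ (pairM i (pairM m t) \inM W) \/
    (pairM m z \inM X /\ ~ (pairM p (pairM z t) \inM D))).
  have {}HB u : u \inM B <-> exists p i w, [/\ u = pairM p (pairM i w), (i <= I)%M &
      forall t, (t <= p)%M -> exists m z, [/\ (m <= w)%M, (z <= w)%M & bad p i m z t]].
    rewrite HB; split=> [[p [_ [i [_ [w [_ [E [iI H]]]]]]]]|[p [i [w [-> iI H]]]]].
      exists p, i, w; split=> // t /ltMS/H[m [/ltMS mw [z [/ltMS zw mz]]]].
      by exists m, z; split.
    bounded_witness p; bounded_witness i; bounded_witness w; split=> //; split=> // t /ltMS/H.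
    move=> [m [z [mw zw mz]]]; exists m; split; first exact: ltMS_le.
    by exists z; split=> //; exact: ltMS_le.
  (* If [p] does not work for [i], each [t <= p] is bad at some stage. Collection gives a common
     bound [w], and the pair of [i] and [w] is then a colour with evidence that can be checked by a
     bounded formula. *)
  have Btot p : exists y, pairM p y \inM B.
    apply: contrapT => noy; apply: not; exists p => i iI; apply: contrapT => not.
    have [C HC] := @comp_bounded M ((EXB t UPTO nvar 2, EXB y UPTO nvar 2,
        nvar 2 == hpair t y /\ EXB m UPTO y, EXB z UPTO y, nvar 0 <= m /\
        (~ (hpair (nvar 1) (hpair m t) IN svar 0) \/
         (hpair m z IN svar 1 /\ ~ (hpair (nvar 0) (hpair z t) IN svar 2))))%hf 3%N 3%N)
      (nenv [:: i; p]) (senv [:: D; X; W]) erefl.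
    cbn in HC.
    have {}HC t y : pairM t y \inM C <-> exists m z, [/\ (m <= y)%M, (z <= y)%M & bad p i m z t].
      rewrite HC; split=> [[t' [_ [y' [_ [E [m [/ltMS my [z [/ltMS zy mz]]]]]]]]]|[m [z [my zy mz]]]].
        by have [-> ->] := pairM_inj E; exists m, z.
      bounded_witness t; bounded_witness y; split=> //; exists m; split; first exact: ltMS_le.
      by exists z; split=> //; exact: ltMS_le.
    have [|w Hw] := @collection M C p.
      move=> t tp; apply: contrapT => nC; apply: not; exists t => // m pm; split.
        apply: contrapT => nW; apply: nC; exists m; apply/HC; exists m, m.
        by split; [exact: leM_refl|exact: leM_refl|split=> //; left].
      move=> z mz; apply: contrapT => nD; apply: nC; have [y [my zy]] := maxM m z.
      by exists y; apply/HC; exists m, z; split=> //; split=> //; right.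
    apply: noy; exists (pairM i w); apply/HB; exists p, i, w; split=> // t tp.
    have [y [yw /HC[m [z [my zy mz]]]]] := Hw t tp.
    by exists m, z; split=> //; [exact: leM_trans yw|exact: leM_trans yw].
  have [|i iI Hi] := pigeonhole_choice ipp _ Btot (I := I).
    by move=> u /HB[p [i [w [-> iI _]]]]; exists p, i, w.
  have /(in_openE _ xrep xc)[N [b [r [c [d [cb dr r0 [e [e0 [N' HN']]] HN]]]]]] := xU i iI.
  (* A [p] of colour [i] is taken beyond the stage [N], the index [N'], a [q] with
     [1 / (q + 1) <= e] and the code of the ball around [b]. This ball then competes at [p] and
     cannot be bad. *)
  have [q qe] := archimedean e0.
  have [k1 [Nk1 N'k1]] := maxM N N'; have [k2 [qk2 tk2]] := maxM q (pairM c d).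
  have [k [k1k k2k]] := maxM k1 k2; have [p [w [kp /HB]]] := Hi k.
  move=> [p' [i' [w' [/pairM_inj[<- /pairM_inj[<- <-]] _ H]]]].
  have k1p := leM_trans k1k kp; have k2p := leM_trans k2k kp.
  have [m [z [_ _ [pm]]]] := H _ (leM_trans tk2 k2p); have k1m := leM_trans k1p pm.
  case=> [|[/xX mz]]; apply; first by apply: HN; exact: leM_trans k1m.
  apply/(HD _ _ _ _ _ _ _ mz cb dr); have := HN' m (leM_trans N'k1 k1m).
  by have := inv_le (leM_trans qk2 k2p); lra.
(* Now [p] works for all [i]. The ball of half the radius around a late entry [xi n0] contains the
   real with margin [e / 4], as the later entries stay within [e / 4] of [xi n0]. *)
have e0 := inv_gt0 p; have half := inv_half p.
set e := 1 / (toq p + 1) in e0 half.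
have [|N HN] := xc (e / 4); first by lra.
have [n0 [Nn0 pn0]] := maxM N p; have [a ax] := rcode_ex (xi n0).
have pp : (p <= p + p + 1)%M by apply/toq_le; rewrite !(toqD, toq1); have := toq_ge0 p; lra.
apply/(in_openE _ xrep xc).
(* This ball is in the code of [U] from stage 0 on: at stage [n] only the stages from [p + p + 1] to
   [n] are checked, and the chosen [t] persists throughout them. *)
exists 0%M, (xi n0), (1 / (toq (p + p + 1)%M + 1)), a, (code_inv (p + p + 1)%M); split=> //.
- exact: rcode_code_inv.
- exact: inv_gt0.
- exists (e / 4); split; first by lra.
  by exists N => n Nn; have := HN n n0 Nn Nn0; rewrite half; lra.
move=> n _; apply/HU; exists n, a, (p + p + 1)%M; split=> //; first by apply/HR; exists (xi n0).
move=> i iI; have [t tp Ht] := Hp i iI; exists t; split; first exact: leM_trans pp.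
  have [tW tD] := Ht n0 pn0.
  have [j [u [_ [/is_tripleE[m [b [r [c [d [cb dr r0 ->]]]]]] /pairM_inj[_]]]]] := Wform _ tW.
  move=> /pairM_inj[_ tE]; have := tD a; rewrite xX tE => /(_ ax).
  by rewrite !(HD _ _ _ _ _ _ _ ax cb dr) half -/e; lra.
by move=> m _ pm; have [] := Ht m (leM_trans pp pm).
Qed.

End PigeonholeToIntersections.

Theorem proposition4p5 : provable RCA0 (fIff IPP OpenIntersections).
Proof.
apply: (completeness RCA0_fsub) => M e f MT; apply/psatE.
(* [psat] reduces the two sides to [IPPM] and [OpenIntersectionsM]. *)
pose N := Model MT (f 0%N).
exact: (conj (@IPP_implies_intersections N) (@intersections_imply_IPP N)).
Qed.
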